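(* Let $F$ be a field of characteristic $\ell\neq 2$, let $V$ be a non-zero finite dimensional vector space over $F$, and let $f:V\times V\to F$ be a non-degenerate bilinear form whose asymmetry $\sigma$ is unipotent. Then $L(f)$ is absolutely reductive if and only if one of the following holds: - $\sigma$ is cyclic, in which case $L(f)$ is abelian; - $\sigma=1_V$, in which case $f$ is symmetric; - $\sigma$ has elementary divisors $(X-1)^2,(X-1)^2$, in which case $L(f)\cong\mathfrak{gl}(2,F)$; - $\sigma$ has elementary divisors $(X-1)^{2m+1},(X-1)$ with $m\geq 1$, in which case $L(f)$ is abelian.
   Context: $L(f)=\{x\in\mathfrak{gl}(V)\mid f(xv,w)=-f(v,xw)\ \text{for all } v,w\in V\}$. The asymmetry $\sigma\in\mathrm{GL}(V)$ of the non-degenerate form $f$ is defined by $f(w,v)=f(v,\sigma w)$ for all $v,w\in V$. An operator is cyclic if its minimal and characteristic polynomials coincide. A Lie algebra is reductive if every solvable ideal is central; a Lie algebra over $F$ is absolutely reductive if it is reductive and stays reductive after extending scalars to an algebraic closure of $F$. *)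

(* Defs.v *)
From HB Require Import structures.
From mathcomp Require Import all_boot all_order all_algebra ssrAC.

Set Implicit Arguments.
Unset Strict Implicit.
Unset Printing Implicit Defensive.

Import GRing.Theory.
Local Open Scope ring_scope.

HB.mixin Record Vector_isLie (F : fieldType) L of Vector F L := {
  lie_br : L -> L -> L;
  lie_br_linl : forall z, linear (lie_br^~ z);
  lie_br_linr : forall z, linear (lie_br z);
  lie_brxx : forall x, lie_br x x = 0;
  lie_jacobi : forall x y z,
    lie_br x (lie_br y z) + lie_br y (lie_br z x) + lie_br z (lie_br x y) = 0
}.

#[short(type="lieAlgType")]
HB.structure Definition LieAlgebra (F : fieldType) :=
  { L of Vector F L & Vector_isLie F L }.

Section LieTheory.
Variables (F : fieldType) (L : lieAlgType F).
Implicit Types (U W I : {vspace L}) (x y z : L).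

HB.instance Definition _ :=
  bilinear_isBilinear.Build F L L L *:%R *:%R (@lie_br F L)
    (@lie_br_linl F L, @lie_br_linr F L).

Definition lie_abelian := forall x y, lie_br x y = 0.

Definition lie_comm U W : {vspace L} :=
  <<[seq lie_br x y | x <- vbasis U, y <- vbasis W]>>%VS.

Definition lie_derived k U : {vspace L} :=
  iter k (fun W => lie_comm W W) U.

Definition lie_solvable U := exists k, lie_derived k U = 0%VS.

Definition lie_ideal I := forall x y, y \in I -> lie_br x y \in I.

Definition lie_central U := forall x y, y \in U -> lie_br x y = 0.

Definition lie_reductive := forall I, lie_ideal I -> lie_solvable I -> lie_central I.

Lemma mem_lie_comm U W x y : x \in U -> y \in W -> lie_br x y \in lie_comm U W.
Proof.
move=> xU yW; rewrite (coord_vbasis xU) linear_sumlz memv_suml // => i _.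
rewrite linearZl_LR memvZ //= (coord_vbasis yW) linear_sumr memv_suml // => j _.
rewrite linearZr_LR memvZ //=; apply/memv_span/allpairsP.
by exists ((vbasis U)`_i, (vbasis W)`_j); split; rewrite ?mem_nth ?size_tuple.
Qed.

Lemma lie_comm_min U W (X : {vspace L}) :
  (forall x y, x \in U -> y \in W -> lie_br x y \in X) -> (lie_comm U W <= X)%VS.
Proof.
move=> h; apply/span_subvP => _ /allpairsP[[x y] [/= xU yW ->]].
by apply: h; apply: vbasis_mem.
Qed.

End LieTheory.

Definition lie_isom (F : fieldType) (L M : lieAlgType F) :=
  exists phi : {linear L -> M}, bijective phi /\ {morph phi : x y / lie_br x y >-> lie_br x y}.

(* The extension of scalars of L along iota : F -> K, in coordinates: K^n with *)
(* the images under iota of the structure constants of L in the basis          *)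
(* vbasis {:L}                                                                 *)

Definition lie_ext (F K : fieldType) (iota : {rmorphism F -> K})
  (L : lieAlgType F) : predArgType := 'rV[K]_(\dim {:L}).

Section ScalarExtension.
Variables (F K : fieldType) (iota : {rmorphism F -> K}) (L : lieAlgType F).
Local Notation lie_ext := (lie_ext iota L).

HB.instance Definition _ := Vector.on lie_ext.

Let e := vbasis {:L}.

Definition lie_ext_in (x : L) : lie_ext :=
  \row_k iota (coord e k x).

Definition lie_ext_br (x y : lie_ext) : lie_ext :=
  \sum_i \sum_j (x 0 i * y 0 j) *: lie_ext_in (lie_br e`_i e`_j).

Let br_linl z : linear (lie_ext_br^~ z).
Proof.
move=> a x y; rewrite /lie_ext_br scaler_sumr -big_split; apply: eq_bigr => i _.
rewrite scaler_sumr -big_split; apply: eq_bigr => j _ /=.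
by rewrite !mxE scalerA -scalerDl mulrDl mulrA.
Qed.

Let br_linr z : linear (lie_ext_br z).
Proof.
move=> a x y; rewrite /lie_ext_br scaler_sumr -big_split; apply: eq_bigr => i _.
rewrite scaler_sumr -big_split; apply: eq_bigr => j _ /=.
by rewrite !mxE scalerA -scalerDl mulrDr mulrCA.
Qed.

HB.instance Definition _ :=
  bilinear_isBilinear.Build K lie_ext lie_ext lie_ext *:%R *:%R lie_ext_br
    (br_linl, br_linr).

Lemma lie_ext_inD : {morph lie_ext_in : x y / x + y}.
Proof. by move=> x y; apply/rowP=> k; rewrite !mxE linearD rmorphD. Qed.

Lemma lie_ext_in0 : lie_ext_in 0 = 0.
Proof. by apply/rowP=> k; rewrite !mxE linear0 rmorph0. Qed.

Lemma lie_ext_inZ a x : lie_ext_in (a *: x) = iota a *: lie_ext_in x.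
Proof. by apply/rowP=> k; rewrite !mxE linearZ rmorphM. Qed.

Lemma lie_ext_in_sum I r (P : pred I) (G : I -> L) :
  lie_ext_in (\sum_(i <- r | P i) G i) = \sum_(i <- r | P i) lie_ext_in (G i).
Proof. exact: (big_morph _ lie_ext_inD lie_ext_in0). Qed.

Lemma lie_ext_in_basis i : lie_ext_in e`_i = \row_k (i == k :> nat)%:R.
Proof.
apply/rowP=> k; rewrite !mxE; case: (ltnP i (\dim {:L})) => hi.
  rewrite -[i]/(nat_of_ord (Ordinal hi)) coord_free ?rmorph_nat //.
  exact: basis_free (vbasisP _).
rewrite nth_default ?size_tuple // linear0 rmorph0; case: eqP => // ik.
by move: hi; rewrite ik leqNgt ltn_ord.
Qed.

Lemma lie_ext_coord (x : lie_ext) : x = \sum_i x 0 i *: lie_ext_in e`_i.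
Proof.
rewrite [LHS]row_sum_delta; apply: eq_bigr => i _; congr (_ *: _).
by rewrite lie_ext_in_basis; apply/rowP=> k; rewrite !mxE eq_sym.
Qed.

Lemma lie_ext_br_in x y :
  lie_ext_br (lie_ext_in x) (lie_ext_in y) = lie_ext_in (lie_br x y).
Proof.
rewrite [in RHS](coord_vbasis (memvf x)) [in RHS](coord_vbasis (memvf y)).
rewrite linear_sumlz lie_ext_in_sum; apply: eq_bigr => i _.
rewrite linear_sumr lie_ext_in_sum; apply: eq_bigr => j _.
by rewrite linearZl_LR linearZr_LR !lie_ext_inZ !mxE scalerA.
Qed.

Let br_basis (W : lie_ext -> lie_ext) (x : lie_ext) :
  linear W -> (forall i, W (lie_ext_in e`_i) = 0) -> W x = 0.
Proof.
move=> linW W0; pose W' := GRing.isLinear.Build K lie_ext lie_ext _ W linW.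
pose Wl : {linear lie_ext -> lie_ext} := HB.pack W W'.
rewrite -[W]/(Wl : _ -> _) [x]lie_ext_coord linear_sum big1 // => i _.
by rewrite linearZ /= W0 scaler0.
Qed.

Let brC x y : lie_ext_br x y + lie_ext_br y x = 0.
Proof.
have brN i j : lie_ext_br (lie_ext_in e`_i) (lie_ext_in e`_j) +
    lie_ext_br (lie_ext_in e`_j) (lie_ext_in e`_i) = 0.
  rewrite !lie_ext_br_in -lie_ext_inD -lie_ext_in0; congr lie_ext_in.
  have := lie_brxx (e`_i + e`_j).
  by rewrite linearDl !linearDr /= !lie_brxx add0r addr0.
pose B u v := lie_ext_br u v + lie_ext_br v u.
apply: (br_basis (W := B^~ y)) => [a u v|i].
  by rewrite /B br_linl br_linr scalerDr addrACA.
apply: (br_basis (W := B _)) => [a u v|j]; last exact: brN.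
by rewrite /B br_linl br_linr scalerDr addrACA.
Qed.

Let brxx x : lie_ext_br x x = 0.
Proof.
rewrite [x]lie_ext_coord.
apply: (big_ind (fun z => lie_ext_br z z = 0)) => [|u v u0 v0|i _].
- exact: linear0r.
- by rewrite linearDl !linearDr /= u0 v0 add0r addr0 brC.
- by rewrite linearZl_LR linearZr_LR /= lie_ext_br_in lie_brxx lie_ext_in0 !scaler0.
Qed.

Let jacobi x y z :
  lie_ext_br x (lie_ext_br y z) + lie_ext_br y (lie_ext_br z x) +
  lie_ext_br z (lie_ext_br x y) = 0.
Proof.
pose J u v w := lie_ext_br u (lie_ext_br v w) + lie_ext_br v (lie_ext_br w u) +
  lie_ext_br w (lie_ext_br u v).
have JC u v w : J u v w = J v w u by rewrite /J -addrA addrC.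
have Jlin u v : linear (J u v).
  move=> a w w'; rewrite /J !(br_linl, br_linr) !scalerDr.
  by rewrite [in RHS]addrACA; congr (_ + _); rewrite addrACA.
rewrite -/(J x y z); apply: br_basis => // k.
rewrite JC; apply: br_basis => // i; rewrite JC; apply: br_basis => // j.
by rewrite /J !lie_ext_br_in -!lie_ext_inD lie_jacobi lie_ext_in0.
Qed.

HB.instance Definition _ :=
  Vector_isLie.Build K lie_ext br_linl br_linr brxx jacobi.

End ScalarExtension.

(* To be used with K an algebraic closure of F *)
Definition lie_absolutely_reductive (F K : fieldType) (iota : {rmorphism F -> K})
    (L : lieAlgType F) :=
  lie_reductive L /\ lie_reductive (lie_ext iota L).

Section GeneralLinearLie.
Variables (n : nat) (F : fieldType).

Definition lie_gl : predArgType := 'M[F]_n.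
HB.instance Definition _ := Vector.on lie_gl.

Definition lie_gl_br (x y : lie_gl) : lie_gl := x *m y - y *m x.

Let br_linl z : linear (lie_gl_br^~ z).
Proof.
move=> a x y; rewrite /lie_gl_br mulmxDl mulmxDr -scalemxAl -scalemxAr.
by rewrite opprD addrACA scalerBr.
Qed.

Let br_linr z : linear (lie_gl_br z).
Proof.
move=> a x y; rewrite /lie_gl_br mulmxDl mulmxDr -scalemxAl -scalemxAr.
by rewrite opprD addrACA scalerBr.
Qed.

Let brxx x : lie_gl_br x x = 0. Proof. exact: subrr. Qed.

Let jacobi x y z :
  lie_gl_br x (lie_gl_br y z) + lie_gl_br y (lie_gl_br z x) +
  lie_gl_br z (lie_gl_br x y) = 0.
Proof.
rewrite /lie_gl_br !(mulmxBl, mulmxBr) !mulmxA !opprB.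
rewrite [LHS](AC (((2*2)*(2*2))*(2*2))
  ((((1*12)*(2*7))*((3*10)*(4*5)))*((6*11)*(8*9)))).
by rewrite /= !(addrN, addNr) !addr0.
Qed.

HB.instance Definition _ :=
  Vector_isLie.Build F lie_gl br_linl br_linr brxx jacobi.

End GeneralLinearLie.

Section Endomorphisms.
Variables (F : fieldType) (V : vectType F).
Implicit Types (u : 'End(V)) (p q : {poly F}).

Definition end_exp u k : 'End(V) := iter k (comp_lfun u) \1%VF.

Definition end_horner u p : 'End(V) := \sum_(i < size p) p`_i *: end_exp u i.

Definition end_unipotent u := exists k, end_exp (u - \1%VF) k = 0.

Definition end_char_poly u : {poly F} :=
  char_poly (passmx.mxof (vbasis {:V}) (vbasis {:V}) u).

Definition end_minpoly u p :=
  p \is monic /\ forall q, end_horner u q = 0 <-> p %| q.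

Definition end_cyclic u := end_minpoly u (end_char_poly u).

(* V, as an F[X]-module on which X acts as u, is the direct sum of the cyclic  *)
(* modules F[X]/(q) for q in s, each q being a power of a prime polynomial:    *)
(* (c_i)_i |-> sum_i c_i(u) w_i is onto V, with kernel the sum of the (q_i).   *)
Definition end_elementary_divisors u (s : seq {poly F}) :=
  (forall q, q \in s -> exists p k,
     [/\ p \is monic, irreducible_poly p, (0 < k)%N & q = p ^+ k]) /\
  exists w : 'I_(size s) -> V,
    (forall v, exists c : 'I_(size s) -> {poly F},
       v = \sum_i end_horner u (c i) (w i)) /\
    (forall c : 'I_(size s) -> {poly F},
       \sum_i end_horner u (c i) (w i) = 0 <-> forall i : 'I_(size s), s`_i %| c i).

End Endomorphisms.

Section FormLie.
Variables (F : fieldType) (V : vectType F) (f : {bilinear V -> V -> F | *%R & *%R}).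

Definition form_nondegenerate :=
  (forall v, (forall w, f v w = 0) -> v = 0) /\
  (forall w, (forall v, f v w = 0) -> w = 0).

Definition form_symmetric := forall v w, f v w = f w v.

Definition form_asymmetry (sigma : 'End(V)) :=
  forall v w, f w v = f v (sigma w).

Definition form_skew_at v w (x : 'End(V)) : F^o := f (x v) w + f v (x w).

Fact form_skew_at_linear v w : linear (form_skew_at v w).
Proof.
move=> a x y; rewrite /form_skew_at !(add_lfunE, scale_lfunE).
by rewrite linearPl linearPr scalerDr addrACA.
Qed.

HB.instance Definition _ v w :=
  GRing.isLinear.Build F 'End(V) F^o _ (form_skew_at v w)
    (form_skew_at_linear v w).

Let e := vbasis {:V}.

Definition form_skew : {vspace 'End(V)} :=
  (\bigcap_(i < \dim {:V}) \bigcap_(j < \dim {:V})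
     lker (linfun (form_skew_at e`_i e`_j)))%VS.

Lemma form_skewP x :
  x \in form_skew <-> forall v w, f (x v) w = - f v (x w).
Proof.
split=> [xL v w|xL]; last first.
  apply/subv_bigcapP => i _; apply/subv_bigcapP => j _.
  by rewrite -memvE memv_ker lfunE /= /form_skew_at xL addNr.
have xe (i j : 'I_(\dim {:V})) : f (x e`_i) e`_j = - f e`_i (x e`_j).
  move/subv_bigcapP/(_ i isT)/subv_bigcapP/(_ j isT): xL.
  by rewrite -memvE memv_ker lfunE /= addr_eq0 => /eqP.
rewrite (coord_vbasis (memvf v)) (linear_sum x) !linear_sumlz -sumrN.
apply: eq_bigr => i _.
rewrite (coord_vbasis (memvf w)) (linear_sum x) !linear_sumr -sumrN.
apply: eq_bigr => j _.
by rewrite !(linearZ_LR x) !(linearZl_LR, linearZr_LR) /= xe !mulrN.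
Qed.

Let comm (x y : 'End(V)) := ((x \o y)%VF - (y \o x)%VF).

Lemma form_skew_comm x y :
  x \in form_skew -> y \in form_skew -> comm x y \in form_skew.
Proof.
move=> /form_skewP xL /form_skewP yL; apply/form_skewP => v w.
rewrite !(add_lfunE, opp_lfunE, comp_lfunE) linearBl linearBr.
by rewrite !xL !yL !xL !opprK opprB addrC.
Qed.

(* L(f) *)
Definition form_lie : predArgType := subvs_of form_skew.
HB.instance Definition _ := Vector.on form_lie.

Definition form_lie_br (x y : form_lie) : form_lie :=
  vsproj form_skew (comm (vsval x) (vsval y)).

Lemma form_lie_brE x y :
  vsval (form_lie_br x y) =
    ((vsval x \o vsval y)%VF - (vsval y \o vsval x)%VF).
Proof. by rewrite vsprojK // form_skew_comm // subvsP. Qed.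

Let br_linl z : linear (form_lie_br^~ z).
Proof.
move=> a x y; apply: subvs_inj; rewrite [RHS]linearP /= !form_lie_brE linearP /=.
rewrite comp_lfunDl comp_lfunDr -comp_lfunZl -comp_lfunZr.
by rewrite opprD addrACA scalerBr.
Qed.

Let br_linr z : linear (form_lie_br z).
Proof.
move=> a x y; apply: subvs_inj; rewrite [RHS]linearP /= !form_lie_brE linearP /=.
rewrite comp_lfunDl comp_lfunDr -comp_lfunZl -comp_lfunZr.
by rewrite opprD addrACA scalerBr.
Qed.

Let brxx x : form_lie_br x x = 0.
Proof. by apply: subvs_inj; rewrite form_lie_brE subrr. Qed.

Let jacobi x y z :
  form_lie_br x (form_lie_br y z) + form_lie_br y (form_lie_br z x) +
  form_lie_br z (form_lie_br x y) = 0.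
Proof.
apply: subvs_inj; rewrite !linearD /= !form_lie_brE.
rewrite !(comp_lfunDl, comp_lfunDr, comp_lfunNl, comp_lfunNr) !comp_lfunA.
rewrite !opprB [LHS](AC (((2*2)*(2*2))*(2*2))
  ((((1*12)*(2*7))*((3*10)*(4*5)))*((6*11)*(8*9)))).
by rewrite /= !(addrN, addNr) !addr0.
Qed.

HB.instance Definition _ :=
  Vector_isLie.Build F form_lie br_linl br_linr brxx jacobi.

End FormLie.

(* Main.v *)
Require Import Defs.
From HB Require Import structures.
From mathcomp Require Import all_boot all_order all_algebra.
From mathcomp Require Import ring.

(** Put [g v w = f v w + f w v], and let [z = (sigma - 1) / (sigma + 1)] be the
Cayley transform of the asymmetry. As 2 is invertible and [sigma] is unipotent,
[g] is symmetric and nondegenerate, [z] is nilpotent and skew for [g], and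
[2 f v w = g v w - g v (z w)]. Hence [L(f)] is the centralizer of [z] in the
orthogonal Lie algebra of [g] ([form_skew_centP]), and the powers of [z] and of
[sigma - 1] have the same kernels ([cayley_pow]), so [z] sees the blocks of
[sigma].

Suppose that [L(f)] is reductive. Its elements that map [V] into [z V + ker z]
and [ker z] into [z V] form a nilpotent ideal ([nil_ideal_solvable]), which must
be central; the blocks are found by exhibiting elements of this ideal and of
[L(f)] that do not commute. Let [z ^ n] be the last nonzero power of [z]. If [n]
is even, the form [g v (z ^ n w)] is symmetric; a vector [u] anisotropic for it
generates a cyclic module [F[z] u], which splits off orthogonally, and the ideal
forces [z] to vanish on the complement and the complement to be at most a line
([odd_classification]; the big block has the odd size [n + 1]). If [n] is odd,
that form is alternating, and centrality forces [n = 1] ([even_index]) and [V]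
to consist of a single pair of blocks of size 2 ([square0_classification]).

Conversely, if [sigma] is cyclic, everything that commutes with it is a
polynomial in it. With a block of odd size and a block of size 1, [L(f)] is the
odd part of [F[z]] plus one line, and an explicit computation shows that it is
abelian ([hook_abelian]). With two blocks of size 2, [L(f)] acts on [V / z V] as
[sl(2)], and the kernel of this action is [F z] ([two_blocks_isom]). If
[sigma = 1], then [L(f)] is an orthogonal Lie algebra. In the last two cases
reductivity has to hold over [F] and over its closure. [gl2_reductive] and
[orthogonal_reductive] therefore concern any Lie algebra with a faithful matrix
representation whose image contains suitable matrix units, a property that
survives the extension of scalars ([ext_rep]); both rest on
[reductive_criterion], which reduces reductivity to the elements [x] for which
[(ad x) ^ 2] has central values. *)

Set Implicit Arguments.
Unset Strict Implicit.
Unset Printing Implicit Defensive.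

Import GRing.Theory.
Local Open Scope ring_scope.

(** * Polynomials in an endomorphism *)

Lemma sizeXB1 (F : fieldType) k : size (('X - 1) ^+ k : {poly F}) = k.+1.
Proof. by rewrite -polyC1 size_exp_XsubC. Qed.

Lemma poly_at1 (F : fieldType) (p : {poly F}) :
  exists q, p = q * ('X - 1) + p.[1]%:P.
Proof.
have /factor_theorem[q] : root (p - p.[1]%:P) 1 by rewrite /root !hornerE subrr.
by rewrite polyC1 => Dp; exists q; rewrite -Dp subrK.
Qed.

Section EndHorner.
Variables (F : fieldType) (V : vectType F).
Implicit Types (u x : 'End(V)) (p q : {poly F}) (v w : V).

Lemma end_expE u k v : end_exp u k v = iter k u v.
Proof. by elim: k => [|k IHk] /=; rewrite ?id_lfunE // comp_lfunE IHk. Qed.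

Lemma end_hornerE u n p v : (size p <= n)%N ->
  end_horner u p v = \sum_(i < n) p`_i *: iter i u v.
Proof.
move=> le_pn; rewrite sum_lfunE (big_ord_widen n (fun i => (p`_i *: end_exp u i) v)) //.
rewrite big_mkcond; apply: eq_bigr => i _.
rewrite scale_lfunE end_expE; case: ltnP => // le_pi.
by rewrite nth_default // scale0r.
Qed.

Lemma end_hornerD u p q v :
  end_horner u (p + q) v = end_horner u p v + end_horner u q v.
Proof.
have le_n : (size (p + q)%R <= maxn (size p) (size q))%N by apply: size_polyD.
rewrite (end_hornerE _ _ le_n) (end_hornerE _ _ (leq_maxl _ (size q))).
rewrite (end_hornerE _ _ (leq_maxr (size p) _)) -big_split /=.
by apply: eq_bigr => i _; rewrite coefD scalerDl.
Qed.

Lemma end_hornerZ u a p v : end_horner u (a *: p) v = a *: end_horner u p v.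
Proof.
rewrite (end_hornerE _ _ (size_scale_leq a p)) (end_hornerE _ _ (leqnn (size p))).
by rewrite scaler_sumr; apply: eq_bigr => i _; rewrite coefZ scalerA.
Qed.

Lemma end_horner0 u v : end_horner u 0 v = 0.
Proof. by rewrite (end_hornerE _ _ (leqnn _)) size_poly0 big_ord0. Qed.

Lemma end_hornerMX u p v : end_horner u (p * 'X) v = u (end_horner u p v).
Proof.
have le_n : (size (p * 'X)%R <= (size p).+1)%N.
  by rewrite (leq_trans (size_polyMleq _ _)) // size_polyX addn2.
rewrite (end_hornerE _ _ le_n) (end_hornerE _ _ (leqnn (size p))).
rewrite big_ord_recl coefMX eqxx scale0r add0r linear_sum.
by apply: eq_bigr => i _; rewrite coefMX /= linearZ.
Qed.

Lemma end_hornerC u a v : end_horner u a%:P v = a *: v.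
Proof. by rewrite (end_hornerE _ _ (size_polyC_leq1 a)) big_ord1 coefC. Qed.

Lemma end_horner1 u v : end_horner u 1 v = v.
Proof. by rewrite -polyC1 end_hornerC scale1r. Qed.

Lemma end_hornerX u v : end_horner u 'X v = u v.
Proof. by rewrite -['X]mul1r end_hornerMX end_horner1. Qed.

Lemma end_hornerB u p q v :
  end_horner u (p - q) v = end_horner u p v - end_horner u q v.
Proof. by rewrite end_hornerD -[- q]scaleN1r end_hornerZ scaleN1r. Qed.

Lemma end_horner_comm u x p v : (forall w, x (u w) = u (x w)) ->
  end_horner u p (x v) = x (end_horner u p v).
Proof.
move=> xu; elim/poly_ind: p => [|p c IHp]; first by rewrite !end_horner0 linear0.
by rewrite !end_hornerD !end_hornerMX !end_hornerC linearD linearZ /= xu IHp.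
Qed.

Lemma end_hornerM u p q v :
  end_horner u (p * q) v = end_horner u p (end_horner u q v).
Proof.
elim/poly_ind: p => [|p c IHp]; first by rewrite mul0r !end_horner0.
rewrite mulrDl mulrAC mul_polyC !end_hornerD !end_hornerMX.
by rewrite end_hornerZ end_hornerC IHp.
Qed.

Lemma end_horner_expn u p k v :
  end_horner u (p ^+ k) v = iter k (end_horner u p) v.
Proof.
by elim: k => [|k IHk] /=; rewrite ?end_horner1 // exprS end_hornerM IHk.
Qed.

Lemma end_hornerXB1 u v : end_horner u ('X - 1) v = u v - v.
Proof. by rewrite end_hornerB end_hornerX end_horner1. Qed.

(** A nonzero polynomial factors as [('X - 1) ^+ j * r] with [r] not vanishing
at 1, and [r] acts on the line of [(u - 1) ^ k v] by the nonzero scalar [r.[1]];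
so it cannot kill [v] when [j <= k]. *)
Lemma end_horner_XB1_eq0 u k v p :
    end_horner u (('X - 1) ^+ k.+1) v = 0 ->
    end_horner u (('X - 1) ^+ k) v != 0 ->
  end_horner u p v = 0 <-> ('X - 1) ^+ k.+1 %| p.
Proof.
move=> Nv0 Nv_neq0; split=> [pv0|/dvdpP[q ->]]; last first.
  by rewrite end_hornerM Nv0 linear0.
have [->|p_neq0] := eqVneq p 0; first by rewrite dvdp0.
have [j [r /implyP/(_ p_neq0) r1 Dp]] := multiplicity_XsubC p 1.
rewrite -polyC1; rewrite polyC1 in Dp.
have [lt_kj|le_jk] := ltnP k j.
  by rewrite Dp polyC1 dvdp_mull // dvdp_exp2l.
have r_top : end_horner u r (end_horner u (('X - 1) ^+ k) v) =
    r.[1] *: end_horner u (('X - 1) ^+ k) v.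
  have [q Dr] := poly_at1 r.
  by rewrite {1}Dr end_hornerD -end_hornerM -mulrA -exprS end_hornerM Nv0 linear0 add0r
    end_hornerC.
case/negP: Nv_neq0; move: r1; rewrite /root => /negPf r1.
have := congr1 (end_horner u (('X - 1) ^+ (k - j))) pv0.
rewrite linear0 -end_hornerM Dp mulrCA -exprD subnK // end_hornerM r_top.
by move/eqP; rewrite scaler_eq0 r1.
Qed.

End EndHorner.

(** * Centralizers of nilpotent skew operators in an orthogonal Lie algebra *)

Section SkewPair.
Variables (F : fieldType) (V : vectType F).
Hypothesis two_neq0 : 2%:R != 0 :> F.
Variable g : {bilinear V -> V -> F | *%R & *%R}.
Hypothesis g_sym : form_symmetric g.
Hypothesis g_nondeg : forall v, (forall w, g v w = 0) -> v = 0.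
Variable z : 'End(V).
Hypothesis z_skew : forall v w, g (z v) w = - g v (z w).
Implicit Types (x y : 'End(V)) (u v w a b c d : V).

Let gDl u v w : g (u + v) w = g u w + g v w. Proof. exact: linearDl. Qed.
Let gDr u v w : g u (v + w) = g u v + g u w. Proof. exact: linearDr. Qed.
Let gNl v w : g (- v) w = - g v w. Proof. exact: linearNl. Qed.
Let gNr v w : g v (- w) = - g v w. Proof. exact: linearNr. Qed.
Let gZl k v w : g (k *: v) w = k * g v w. Proof. by rewrite linearZl_LR. Qed.
Let gZr k v w : g v (k *: w) = k * g v w. Proof. by rewrite linearZr_LR. Qed.
Let g0l w : g 0 w = 0. Proof. exact: linear0l. Qed.
Let g0r v : g v 0 = 0. Proof. exact: linear0r. Qed.
Let gE := (gDl, gDr, gNl, gNr, gZl, gZr, g0l, g0r).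

(** The centralizer of [z] in the orthogonal Lie algebra of [g]. *)
Definition skew_cent x :=
  (forall v w, g (x v) w = - g v (x w)) /\ (forall v, x (z v) = z (x v)).

Lemma form_witness v : v != 0 -> exists w, g v w != 0.
Proof.
move=> v_neq0; pose phi : 'Hom(V, F^o) := linfun (g v : V -> F^o).
have phiE w : phi w = g v w by rewrite lfunE.
have /lfunPn[w] : phi != 0.
  apply: contra v_neq0 => /eqP phi0; apply/eqP/g_nondeg => w.
  by rewrite -phiE phi0 zero_lfunE.
by rewrite zero_lfunE phiE; exists w.
Qed.

Lemma skew_iter i v w : g (iter i z v) w = (-1) ^+ i * g v (iter i z w).
Proof.
elim: i v w => [|i IHi] v w; first by rewrite mul1r.
by rewrite iterS z_skew IHi -iterSr exprS mulN1r mulNr.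
Qed.

Lemma iter_linear0 i : iter i z 0 = 0.
Proof. by elim: i => //= i ->; rewrite linear0. Qed.

Lemma iterD_lin i v w : iter i z (v + w) = iter i z v + iter i z w.
Proof. by elim: i => //= i ->; rewrite linearD. Qed.

Lemma iterZ_lin i k v : iter i z (k *: v) = k *: iter i z v.
Proof. by elim: i => //= i ->; rewrite linearZ. Qed.

(** One of [v], [w], [v + w] is anisotropic, because
[h (v + w) (v + w) = 2 * h v w] when the first two are isotropic. *)
Lemma polarize (h : V -> V -> F) v w :
    (forall a b c, h (a + b) c = h a c + h b c) -> (forall a b, h a b = h b a) ->
  h v w != 0 -> exists i j : bool, let t := v *+ i + w *+ j in h t t != 0.
Proof.
move=> hD hC hvw; have [hvv|] := eqVneq (h v v) 0; last first.
  by exists true, false; rewrite /= addr0.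
have [hww|] := eqVneq (h w w) 0; last by exists false, true; rewrite /= add0r.
exists true, true; rewrite /= hD (hC v) (hC w) !hD hvv hww (hC w) add0r addr0.
by rewrite -mulr2n -mulr_natl mulf_neq0.
Qed.

(** ** Operators of rank two and their analogues over [F[z]] *)

(** The infinitesimal rotation in the plane of [a] and [b]. *)
Definition wedgef a b v := g b v *: a - g a v *: b.

Fact wedgef_linear a b : linear (wedgef a b).
Proof.
move=> k v w; rewrite /wedgef !gE !scalerDl scalerBr !scalerA opprD.
by rewrite addrACA.
Qed.
HB.instance Definition _ a b :=
  GRing.isLinear.Build F V V _ (wedgef a b) (wedgef_linear a b).

Definition wedge a b : 'End(V) := linfun (wedgef a b).

Lemma wedgeE a b v : wedge a b v = g b v *: a - g a v *: b.
Proof. by rewrite lfunE. Qed.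

(** The vectors of [ker z] are orthogonal to [z V], so both products of [z] with
the rotation vanish. *)
Lemma wedge_cent a b : z a = 0 -> z b = 0 -> skew_cent (wedge a b).
Proof.
move=> za zb; split=> [v w|v]; rewrite !wedgeE ?gE.
  by rewrite (g_sym v a) (g_sym v b); ring.
have gz c : z c = 0 -> g c (z v) = 0.
  by move=> zc; apply/eqP; rewrite -oppr_eq0 -z_skew zc g0l.
by rewrite !gz // [RHS]linearB !linearZ /= za zb oppr0 !scaler0 !scale0r.
Qed.

Section Dyad.
Variable n : nat.
Hypothesis z_nil : forall v, iter n.+1 z v = 0.

(** The module [V] over [F[z] / (z ^ n.+1)] carries the sesquilinear form
[H b v = \sum_i g b (z ^ i v) z ^ (n - i)], and this is the rank-one operator
[v |-> H b v a]; it therefore commutes with [z]. *)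
Definition dyadf a b v := \sum_(i < n.+1) g b (iter i z v) *: iter (n - i) z a.

Fact dyadf_linear a b : linear (dyadf a b).
Proof.
move=> k v w; rewrite /dyadf scaler_sumr -big_split; apply: eq_bigr => i _ /=.
by rewrite iterD_lin iterZ_lin !gE scalerDl scalerA.
Qed.
HB.instance Definition _ a b :=
  GRing.isLinear.Build F V V _ (dyadf a b) (dyadf_linear a b).

Definition dyad a b : 'End(V) := linfun (dyadf a b).

Lemma dyadE a b v :
  dyad a b v = \sum_(i < n.+1) g b (iter i z v) *: iter (n - i) z a.
Proof. by rewrite lfunE. Qed.

Lemma dyad_comm a b v : dyad a b (z v) = z (dyad a b v).
Proof.
rewrite !dyadE linear_sum [LHS]big_ord_recr [RHS]big_ord_recl /= linearZ subn0 /=.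
rewrite -iterSr -[z (iter n z a)]iterS !z_nil g0r scale0r scaler0 addr0 add0r;
  apply: eq_bigr => i _.
by rewrite linearZ /= /bump add1n -iterSr -[z (iter (n - i.+1) z a)]iterS subnSK.
Qed.

Lemma dyad_iter a b i v : dyad a b (iter i z v) = iter i z (dyad a b v).
Proof. by elim: i => //= i IHi; rewrite dyad_comm IHi. Qed.

(** Each of the [n] factors [z] changes the sign when it crosses [g]: the form
is hermitian for the involution [z |-> - z] when [n] is even, and antihermitian
when [n] is odd. *)
Lemma dyad_adj a b v w : g (dyad a b v) w = (-1) ^+ n * g v (dyad b a w).
Proof.
rewrite !dyadE linear_sumlz linear_sumr (reindex_inj rev_ord_inj) mulr_sumr.
apply: eq_bigr => i _ /=; rewrite linearZl_LR linearZr_LR /= subSS.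
have le_in : (i <= n)%N by rewrite -ltnS.
rewrite subKn // (skew_iter i a) (g_sym v) (skew_iter (n - i) b).
have -> : (-1) ^+ n = (-1) ^+ i * (-1) ^+ (n - i) :> F by rewrite -exprD subnKC.
have ss : (-1) ^+ (n - i) * (-1) ^+ (n - i) = 1 :> F by rewrite -expr2 sqrr_sign.
rewrite -[LHS]mulr1 -[X in _ * X = _]ss;
  move: (_ ^+ (n - i)) (_ ^+ i) (g b _) (g a _) => s t p q.
by ring.
Qed.

(** Multiplying [H b v a] by [z ^ n] leaves only the constant term of [H b v],
the summand with [i = n]. *)
Lemma dyad_top a b v :
  iter n z (dyad a b v) = g b (iter n z v) *: iter n z a.
Proof.
rewrite -dyad_iter dyadE big_ord_recl /= subn0 big1 ?addr0 // => i _.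
have -> : z (iter (0 + i) z (iter n z v)) = 0; last by rewrite g0r scale0r.
by rewrite add0n -iterD -iterS -addnS iterD z_nil iter_linear0.
Qed.

Lemma z_dyad_square0 a b v : z (z a) = 0 ->
  z (dyad a b v) = g b (iter n z v) *: z a.
Proof.
move=> zza; rewrite dyadE big_ord_recr linearD linear_sum /= subnn big1 ?add0r.
  by rewrite linearZ.
move=> i _; have [k ->] : exists k, (n - i = k.+1)%N.
  by exists (n - i.+1)%N; rewrite subnSK.
by rewrite linearZ /= -[z (z _)]/(iter k.+2 z a) !iterSr zza iter_linear0 scaler0.
Qed.

End Dyad.

(** ** Square-zero operators *)

Section SquareZero.
Hypothesis zz0 : forall v, z (z v) = 0.

Lemma square0_isotropic v w : g (z v) (z w) = 0.
Proof. by rewrite z_skew zz0 g0r oppr0. Qed.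

Lemma skew_self0 x v : (forall v w, g (x v) w = - g v (x w)) -> g v (x v) = 0.
Proof.
move=> xs; apply: (mulfI two_neq0); rewrite mulr0 mulr_natl mulr2n.
by rewrite {1}g_sym xs addNr.
Qed.

(** A hyperbolic pair for [g _ (z _)] inside which [g] vanishes. *)
Definition adapted a c :=
  [/\ g a (z c) = 1, g a a = 0, g c c = 0 & g a c = 0].

(** When [z ^ 2 = 0], the orthogonal projection onto the span of [a], [c], [z a]
and [z c]. *)
Definition adapted_proj a c v :=
  g v (z c) *: a - g v (z a) *: c - g v c *: z a + g v a *: z c.

(** Rescale [c0], then add elements of [z V] to both vectors: they do not change
the form [g _ (z _)], and they absorb the values of [g] on the pair. *)
Lemma adapted_exists a0 c0 : g a0 (z c0) != 0 -> exists a c, adapted a c.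
Proof.
move=> h_neq0; set h := g a0 (z c0) in h_neq0.
have h' : g c0 (z a0) = - h by rewrite -[LHS]opprK -z_skew g_sym.
have [saa scc] : g a0 (z a0) = 0 /\ g c0 (z c0) = 0 by rewrite !skew_self0.
(* [t], [s] and [r] kill [g a a], [g c c] and [g a c] respectively. *)
pose r := g a0 c0 / h; pose s := h^-1 * g c0 c0 / h / 2%:R.
pose t := - g a0 a0 / h / 2%:R.
exists (a0 + r *: z a0 + t *: z c0), (h^-1 *: c0 + s *: z a0).
rewrite /r /s /t; split; rewrite ?linearD /= ?linearZ /= ?zz0 ?gE ?(g_sym (z _) a0)
  ?(g_sym (z _) c0);
  rewrite ?square0_isotropic ?saa ?scc ?h' -/h; field=> //.
all: by rewrite h_neq0 two_neq0.
Qed.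

Section Adapted.
Variables a c : V.
Hypothesis ac : adapted a c.

Lemma adapted_pairing :
  (g (z c) a = 1) * (g c (z a) = -1) * (g (z a) c = -1) * (g a (z a) = 0) *
  (g (z a) a = 0) * (g c (z c) = 0) * (g (z c) c = 0) * (g c a = 0) *
  (g a (z c) = 1) * (g a a = 0) * (g c c = 0) * (g a c = 0).
Proof.
have [ac1 aa cc ac0] := ac.
have ca1 : g c (z a) = -1 by rewrite -[LHS]opprK -z_skew g_sym ac1.
rewrite !(g_sym (z _)) ca1 ac1 !skew_self0 // (g_sym c a); by do !split.
Qed.

Lemma adapted_projP v (v' := v - adapted_proj a c v) :
  [/\ g v' a = 0, g v' c = 0, g v' (z a) = 0 & g v' (z c) = 0].
Proof.
rewrite /v' /adapted_proj; split; rewrite !gE !adapted_pairing ?square0_isotropic; ring.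
Qed.

Lemma adapted_perp v w : g v a = 0 -> g v c = 0 -> g v (z a) = 0 -> g v (z c) = 0 ->
  g v (adapted_proj a c w) = 0.
Proof. by rewrite /adapted_proj !gE => -> -> -> ->; rewrite !mulr0 !oppr0 !addr0. Qed.

End Adapted.
End SquareZero.

(** ** Blocks of [z] when a nilpotent ideal of the centralizer is central *)

(** The elements of the centralizer that map [V] into [z V + ker z] and [ker z]
into [z V] form a nilpotent ideal. The proofs play elements of this ideal
against elements of the centralizer. *)
Section NilCentral.
Hypothesis nil_central : forall x y, skew_cent x -> skew_cent y ->
  (forall v, x v \in (limg z + lker z)%VS) ->
  (forall v, z v = 0 -> x v \in limg z) -> forall v, x (y v) = y (x v).

Let nil_central_img x y : skew_cent x -> skew_cent y ->
  (forall v, x v \in limg z) -> forall v, x (y v) = y (x v).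
Proof.
move=> xL yL xz; apply: nil_central => // v.
by apply: (subvP (addvSl _ _)).
Qed.

Section Index.
Variable n : nat.
Hypothesis z_nil : forall v, iter n.+1 z v = 0.

Let dyad := dyad n.

Let dyad_perp b a v : (forall i, g b (iter i z v) = 0) -> dyad a b v = 0.
Proof. by move=> bv; rewrite dyadE // big1 // => i _; rewrite bv scale0r. Qed.

Let g_dyad d a b v : (forall i, g d (iter i z a) = 0) -> g d (dyad a b v) = 0.
Proof.
by move=> da; rewrite dyadE // linear_sumr big1 // => i _; rewrite gZr da mulr0.
Qed.

Let perp_sym b u : (forall i, g b (iter i z u) = 0) ->
  forall i, g u (iter i z b) = 0.
Proof. by move=> bu i; rewrite g_sym skew_iter bu mulr0. Qed.

(** Write [T_ab] for [dyad a b], and let [z ^ 2 d = 0] and [d] be orthogonal to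
[F[z] u]. The element [z T_uu] of the ideal commutes with [T_ud - T_du]; at [u]
this reads [z d = 0], up to the nonzero factor [g u (z ^ n u) ^ 2]. In general
some [z ^ j b] is such a vector [d]. *)
Lemma odd_perp_ker u b : ~~ odd n -> g u (iter n z u) != 0 ->
  (forall i, g b (iter i z u) = 0) -> z b = 0.
Proof.
move=> n_even huu.
have square0 d : (forall i, g d (iter i z u) = 0) -> z (z d) = 0 -> z d = 0.
  move=> du zzd; have ud := perp_sym du.
  pose x := dyad u d - dyad d u; pose y := (z \o dyad u u)%VF.
  have adj := dyad_adj n; have comm := dyad_comm z_nil.
  have sgn : (-1) ^+ n = 1 :> F by rewrite -signr_odd (negPf n_even).
  have xL : skew_cent x.
    split=> [v w|v]; rewrite !(add_lfunE, opp_lfunE).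
      by rewrite !gE !adj sgn; ring.
    by rewrite !comm linearB.
  have yL : skew_cent y.
    split=> [v w|v]; rewrite !comp_lfunE; last by rewrite comm.
    by rewrite z_skew adj comm sgn mul1r.
  have yz v : y v \in limg z by rewrite comp_lfunE memv_img ?memvf.
  have := nil_central_img yL xL yz u.
  rewrite !(comp_lfunE, add_lfunE, opp_lfunE) !comm (dyad_perp _ du) sub0r.
  have -> : dyad u u (- dyad d u u) = 0.
    by rewrite linearN /= [dyad u u _]dyad_perp ?oppr0 // => i;
      rewrite -(dyad_iter z_nil) g_dyad.
  have -> : dyad u d (dyad u u u) = 0.
    by apply: dyad_perp => i; rewrite -(dyad_iter z_nil) g_dyad.
  rewrite linear0 sub0r z_dyad_square0 // dyad_top // gZr => /esym/eqP.
  by rewrite oppr_eq0 scaler_eq0 mulf_eq0 (negPf huu) => /eqP.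
move=> bu; have descend j : z (iter j z b) = 0 -> z b = 0.
  elim: j => // j IHj zzb; apply/IHj/square0 => // i.
  by rewrite skew_iter -iterD bu mulr0.
by apply: (descend n); apply: z_nil.
Qed.

Definition cyclic_span u : {vspace V} := <<mkseq (fun i => iter i z u) n.+1>>%VS.

Lemma cyclic_span_iter u i : iter i z u \in cyclic_span u.
Proof.
have [lt_in|le_ni] := ltnP i n.+1.
  by apply: memv_span; apply/mapP; exists i; rewrite ?mem_iota.
by rewrite -(subnK le_ni) iterD z_nil iter_linear0 mem0v.
Qed.

Lemma cyclic_span_perp u b w : (forall i, g b (iter i z u) = 0) ->
  w \in cyclic_span u -> g b w = 0.
Proof.
move=> bu; rewrite /cyclic_span -[mkseq _ _]/(val [tuple of mkseq (fun i => iter i z u)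
  n.+1]).
move/coord_span=> ->; rewrite linear_sumr big1 // => i _.
by rewrite linearZr_LR /= nth_mkseq // bu mulr0.
Qed.

(** The Gram matrix of [u, z u, ..., z ^ n u] is antitriangular, with
[g u (z ^ n u)] up to sign on the antidiagonal; the induction clears the
pairings of [v] with [z ^ i u] from [i = n] downwards. *)
Lemma cyclic_span_split u v : g u (iter n z u) != 0 ->
  exists w b,
    [/\ w \in cyclic_span u, forall i, g b (iter i z u) = 0 & v = w + b].
Proof.
move=> huu; suff split_from j v' : (forall i, (j <= i)%N -> g v' (iter i z u) = 0) ->
    exists w b,
      [/\ w \in cyclic_span u, forall i, g b (iter i z u) = 0 & v' = w + b].
  apply: (split_from n.+1) => i le_ni.
  by rewrite -(subnK le_ni) iterD z_nil iter_linear0 g0r.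
have small i : (n < i)%N -> iter i z u = 0.
  by move=> lt_ni; rewrite -(subnK lt_ni) iterD z_nil iter_linear0.
elim: j v' => [|j IHj] v' v'j.
  by exists 0, v'; split=> [|i|]; rewrite ?mem0v ?add0r ?v'j.
have [lt_nj|le_jn] := ltnP n j.
  apply: IHj => i le_ji; rewrite small ?g0r // (leq_trans lt_nj) //.
pose k := g v' (iter j z u) / ((-1) ^+ (n - j) * g u (iter n z u)).
have gu i : g (iter (n - j) z u) (iter i z u) =
    (-1) ^+ (n - j) * g u (iter (n - j + i) z u) by rewrite skew_iter iterD.
have [i le_ji|w [b [wA b_perp Dv']]] := IHj (v' - k *: iter (n - j) z u).
  rewrite !gE gu; move: le_ji; rewrite leq_eqVlt => /predU1P[<-|lt_ji].
    by rewrite subnK // /k divfK ?subrr // mulf_neq0 ?signr_eq0.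
  rewrite v'j // small ?g0r ?mulr0 ?subr0 //.
  by rewrite -[X in (X < _)%N](subnK le_jn) ltn_add2l.
exists (k *: iter (n - j) z u + w), b.
split=> //; first by rewrite memvD ?memvZ ?cyclic_span_iter.
by rewrite -addrA -Dv' addrC subrK.
Qed.

(** On the orthogonal complement of [F[z] u] the operator [z] vanishes. If it
contains an anisotropic vector [b] and a vector [d] orthogonal to [b], then the
rotation [b /\ d] is in the centralizer and commutes with the element
[z ^ n u /\ b] of the ideal; evaluated at [u], this gives [d = 0]. *)
Lemma odd_classification u : (0 < n)%N -> ~~ odd n -> g u (iter n z u) != 0 ->
  (forall v, v \in cyclic_span u) \/
  exists b, [/\ z b = 0, g b b != 0, forall i, g b (iter i z u) = 0 &
    forall v, exists k, v - k *: b \in cyclic_span u].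
Proof.
move=> n_gt0 n_even huu; set A := cyclic_span u.
have [|/subvPn[v _ vA]] := boolP (fullv <= A)%VS.
  by move/subvP=> fA; left=> v; rewrite fA ?memvf.
right; have [w [b0 [wA b0u Dv]]] := cyclic_span_split v huu.
have b0_neq0 : b0 != 0 by apply: contraNneq vA => b00; rewrite Dv b00 addr0.
have [t b0t] := form_witness b0_neq0.
have [t' [b1 [t'A b1u Dt]]] := cyclic_span_split t huu.
have b01 : g b0 b1 != 0 by rewrite Dt gDr (cyclic_span_perp b0u t'A) add0r in b0t.
have [i [j]] := polarize gDl g_sym b01.
set b := _ + _ => bb; have bu m : g b (iter m z u) = 0.
  by rewrite /b -!scaler_nat !gE b0u b1u !mulr0 addr0.
have zb := odd_perp_ker n_even huu bu; clearbody b.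
exists b; split=> // v1; have [w1 [b' [w1A b'u ->]]] := cyclic_span_split v1 huu.
exists (g b' b / g b b); suff d0 : b' - (g b' b / g b b) *: b = 0.
  by rewrite -addrA d0 addr0.
set d := (X in X = 0); have db : g d b = 0 by rewrite !gE divfK ?subrr.
have du m : g d (iter m z u) = 0 by rewrite !gE b'u bu mulr0 subrr.
clearbody d; have zd : z d = 0 by apply: odd_perp_ker du.
have ztop : z (iter n z u) = 0 by apply: z_nil.
have imgtop : iter n z u \in limg z by rewrite -(prednK n_gt0) iterS memv_img ?memvf.
have xL := wedge_cent ztop zb; have yL := wedge_cent zb zd.
have gtop v2 : z v2 = 0 -> g (iter n z u) v2 = 0.
  move=> zv2; rewrite -(prednK n_gt0) iterS z_skew zv2 g0r oppr0 //.
have bu0 : g b u = 0 := bu 0%N; have du0 : g d u = 0 := du 0%N.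
have yu : wedge b d u = 0 by rewrite wedgeE du0 bu0 !scale0r subrr.
have xu : wedge (iter n z u) b u = - g (iter n z u) u *: b.
  by rewrite wedgeE bu0 scale0r sub0r scaleNr.
have yb : wedge b d b = - g b b *: d by rewrite wedgeE db scale0r sub0r scaleNr.
have := nil_central xL yL _ _ u.
rewrite yu xu linear0 linearZ /= yb scalerA => comm_u.
have /esym/eqP : 0 = - g (iter n z u) u * - g b b *: d.
  apply: comm_u => [v2|v2 zv2]; rewrite wedgeE; last first.
    by rewrite gtop // scale0r subr0 memvZ.
  by rewrite memv_add ?memvZ // -scaleNr memvZ // memv_ker zb.
rewrite scaler_eq0 mulf_eq0 !oppr_eq0 (negPf bb) orbF g_sym (negPf huu).
by move/eqP.
Qed.

(** For odd [n] the form [g v (z ^ n w)] is alternating and [T_uu], [T_ww] lie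
in the centralizer. If [1 < n], then [z ^ 2 T_uu] is in the ideal and commutes
with [T_ww]; at [u], multiplied by [z ^ (n - 2)], this reads, up to sign,
[(g w (z ^ n u)) ^ 2 z ^ n u = 0]. *)
Lemma even_index u w : odd n -> g w (iter n z u) != 0 -> (n <= 1)%N.
Proof.
move=> n_odd hwu; rewrite leqNgt; apply/negP => n_gt1.
have sgn : (-1) ^+ n = -1 :> F by rewrite -signr_odd n_odd.
have adj := dyad_adj n; have comm := dyad_comm z_nil.
have xL : skew_cent (dyad w w) by split=> [v t|v]; rewrite ?comm // adj sgn mulN1r.
pose y := (z \o z \o dyad u u)%VF.
have yL : skew_cent y.
  split=> [v t|v]; rewrite !comp_lfunE ?comm //.
  by rewrite !z_skew adj !comm sgn; ring.
have yz v : y v \in limg z by rewrite !comp_lfunE memv_img ?memvf.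
have hC v t : g v (iter n z t) = - g t (iter n z v).
  by rewrite g_sym skew_iter sgn mulN1r.
have huu : g u (iter n z u) = 0.
  apply: (mulfI two_neq0); rewrite mulr0 mulr_natl mulr2n {1}hC addNr //.
have := congr1 (iter (n - 2) z) (nil_central_img yL xL yz u).
rewrite !comp_lfunE !comm -![z (z _)]/(iter 2 z _) -!iterD subnK // !dyad_top //.
rewrite !gZr huu mul0r scale0r => /eqP; rewrite scaler_eq0.
rewrite mulf_eq0 (negPf hwu) hC oppr_eq0 (negPf hwu) /=.
by move/eqP=> topu; move: hwu; rewrite topu g0r eqxx.
Qed.

End Index.

(** The operator [T_aa] maps [c] to [a], so it cannot commute with [z c /\ d']
for a nonzero [d'] orthogonal to [a] and [c]. Taking [d' = z d], then [d']
itself in the orthogonal complement of the adapted pair, shows first that [z]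
vanishes on that complement, then that the complement is zero. *)
Lemma square0_classification a0 c0 :
  (forall v, z (z v) = 0) -> g a0 (z c0) != 0 ->
  exists a c, adapted a c /\ forall v, v = adapted_proj a c v.
Proof.
move=> zz0 ac0; have [a [c ac]] := adapted_exists zz0 ac0.
exists a, c; split=> // v0.
have E := adapted_pairing ac; have iso := square0_isotropic zz0.
have z_nil v : iter 2 z v = 0 by apply: zz0.
have adj := dyad_adj 1; have comm := dyad_comm z_nil.
pose x := dyad 1 a a.
have xE v : x v = g a v *: z a + g a (z v) *: a.
  by rewrite /x dyadE // !big_ord_recl big_ord0 addr0.
have xL : skew_cent x by split=> [v t'|v]; rewrite ?comm // adj expr1 mulN1r.
have xc : x c = a by rewrite xE !E scale0r add0r scale1r.
have img v : z v \in limg z by rewrite memv_img ?memvf.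
pose perp d := [/\ g d a = 0, g d c = 0, g d (z a) = 0 & g d (z c) = 0].
have perp_z d : perp d -> z d = 0.
  move=> [da dc dza dzc].
  have yL : skew_cent (wedge (z c) (z d)) by apply: wedge_cent; rewrite zz0.
  have yc : wedge (z c) (z d) c = 0.
    by rewrite wedgeE z_skew dzc E oppr0 !scale0r subrr.
  have ya : wedge (z c) (z d) a = - z d.
    by rewrite wedgeE z_skew dza E oppr0 scale0r scale1r sub0r.
  have := nil_central_img yL xL _ c; rewrite xc yc ya linear0 => zd0.
  apply/oppr_inj; rewrite oppr0 zd0 // => v.
  by rewrite wedgeE -scaleNr memvD ?memvZ.
apply/eqP; rewrite -subr_eq0; set e := v0 - _; apply/negPn/negP => /form_witness[t' et].
have perpB v : perp (v - adapted_proj a c v) by apply: adapted_projP.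
have e_perp : perp e := perpB v0; clearbody e.
have ee1 : g e (t' - adapted_proj a c t') != 0.
  by case: e_perp => ea ec eza ezc; rewrite gDr gNr adapted_perp ?subr0.
have [i [j]] := polarize gDl g_sym ee1; set b := _ + _ => bb.
have [ba bc bza bzc] : perp b.
  have [ea ec eza ezc] := e_perp; have [fa fc fza fzc] := perpB t'.
  by rewrite /perp /b -!scaler_nat !gDl !gZl ea ec eza ezc fa fc fza fzc !mulr0 addr0.
have zb := perp_z b (And4 ba bc bza bzc); clearbody b.
have yL : skew_cent (wedge (z c) b) by apply: wedge_cent; rewrite ?zz0.
have yc : wedge (z c) b c = 0 by rewrite wedgeE bc E !scale0r subrr.
have ya : wedge (z c) b a = - b by rewrite wedgeE ba E scale0r scale1r sub0r.
have := nil_central yL xL _ _ c; rewrite xc yc ya linear0 => b0.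
suff b_eq0 : b = 0 by move: bb; rewrite b_eq0 /= g0l eqxx.
apply/oppr_inj; rewrite oppr0 b0 // => [v|v zv]; rewrite wedgeE.
  by rewrite memv_add ?memvZ // -scaleNr memvZ // memv_ker zb.
by rewrite z_skew zv g0r oppr0 scale0r subr0 memvZ.
Qed.

End NilCentral.

(** The parity of the index [n] decides whether the form [g v (z ^ n w)] is
symmetric or alternating. *)
Theorem nil_central_classification :
    (exists k, forall v, iter k z v = 0) -> z != 0 ->
    (forall x y, skew_cent x -> skew_cent y ->
      (forall v, x v \in (limg z + lker z)%VS) ->
      (forall v, z v = 0 -> x v \in limg z) -> forall v, x (y v) = y (x v)) ->
  (exists n u,
    [/\ (0 < n)%N, ~~ odd n, forall v, iter n.+1 z v = 0, iter n z u != 0 &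
      (forall v, v \in cyclic_span n u) \/
      exists b, [/\ z b = 0, g b b != 0, forall i, g b (iter i z u) = 0 &
        forall v, exists k, v - k *: b \in cyclic_span n u]]) \/
  (forall v, z (z v) = 0) /\
    exists a c, adapted a c /\ forall v, v = adapted_proj a c v.
Proof.
move=> z_nil z_neq0 nil_central.
have nilP k : reflect (forall v, iter k z v = 0) (end_exp z k == 0).
  apply: (iffP eqP) => [zk v|zk]; first by rewrite -end_expE zk zero_lfunE.
  by apply/lfunP => v; rewrite end_expE zk zero_lfunE.
have ex_k : exists k, end_exp z k == 0 by have [k /nilP zk] := z_nil; exists k.
case: (ex_minnP ex_k) => [[|[|n]]] /nilP zk k_min.
- by case/negP: z_neq0; apply/eqP/lfunP => v;
  rewrite -[v]/(iter 0 z v) zk linear0 zero_lfunE.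
- by case/negP: z_neq0; apply/eqP/lfunP => v; rewrite zero_lfunE; apply: zk.
have /lfunPn[w] : end_exp z n.+1 != 0.
  by apply/negP => /k_min; rewrite ltnn.
rewrite zero_lfunE end_expE => /form_witness[u]; rewrite g_sym => huw.
have [n_odd|n_even] := boolP (odd n.+1).
  have n1 := even_index nil_central zk n_odd huw.
  have n0 : n = 0%N by case: n n1 {zk k_min huw n_odd}.
  rewrite n0 in zk huw; right; split=> //.
  by apply: (square0_classification nil_central (a0 := u) (c0 := w)).
left; pose h v1 v2 := g v1 (iter n.+1 z v2).
have hD v1 v2 v3 : h (v1 + v2) v3 = h v1 v3 + h v2 v3 by apply: gDl.
have hC v1 v2 : h v1 v2 = h v2 v1.
  by rewrite /h g_sym skew_iter -signr_odd (negPf n_even) mul1r.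
have [i [j]] := polarize hD hC (huw : h u w != 0).
set t := _ + _; rewrite /= => htt; exists n.+1, t; split=> //.
  by apply: contraNneq htt => topt; rewrite /h topt g0r.
exact: odd_classification.
Qed.

(** ** The centralizer for two blocks of size 2 *)

Section TwoBlocks.
Hypothesis zz0 : forall v, z (z v) = 0.
Variables a c : V.
Hypothesis ac : adapted a c.
Hypothesis span_ac : forall v, v = adapted_proj a c v.

Let E := adapted_pairing ac.
Let iso := square0_isotropic zz0.

(** The centralizer acts on [V / z V], spanned by [a] and [c], by traceless
matrices; the remaining freedom is a multiple of [z], recorded as a scalar. *)
Definition gl_entry (i j : 'I_2) x : F :=
  let s := - g (x a) c in
  if i == 0 then if j == 0 then s + g (x a) (z c) else g (x c) (z c)
  else if j == 0 then - g (x a) (z a) else s - g (x a) (z c).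

Lemma gl_entry_linear i j k x y :
  gl_entry i j (k *: x + y) = k * gl_entry i j x + gl_entry i j y.
Proof.
rewrite /gl_entry !(add_lfunE, scale_lfunE) !gE.
by do 2!case: ifP => _; ring.
Qed.

Lemma skew_cent_adapted x : skew_cent x ->
  x a = g (x a) (z c) *: a - g (x a) (z a) *: c - g (x a) c *: z a /\
  x c = g (x c) (z c) *: a - g (x a) (z c) *: c - g (x a) c *: z c.
Proof.
case=> xs xz; have self v : g (x v) v = 0 by rewrite g_sym skew_self0.
split; rewrite {1}[LHS]span_ac /adapted_proj self scale0r ?addr0 ?subr0 //.
have -> : g (x c) (z a) = g (x a) (z c) by rewrite xs xz -z_skew g_sym.
by rewrite [g (x c) a]xs (g_sym c) scaleNr.
Qed.

Let comp_adapted x y p q r s : skew_cent x ->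
  y a = p *: a - q *: c - r *: z a -> y c = s *: a - p *: c - r *: z c ->
  x (y a) = p *: x a - q *: x c - r *: z (x a) /\
  x (y c) = s *: x a - p *: x c - r *: z (x c).
Proof.
move=> [_ xz] -> ->; have xE k1 k2 k3 v1 v2 v3 :
    x (k1 *: v1 - k2 *: v2 - k3 *: v3) = k1 *: x v1 - k2 *: x v2 - k3 *: x v3.
  by rewrite !linearB !linearZ.
by rewrite !xE !xz.
Qed.

(** The scalar part cancels in commutators and the traceless parts compose as
matrices. *)
Lemma gl_entry_comm x y i j : skew_cent x -> skew_cent y ->
  gl_entry i j ((x \o y)%VF - (y \o x)%VF) =
    \sum_k gl_entry i k x * gl_entry k j y - \sum_k gl_entry i k y * gl_entry k j x.
Proof.
move=> xL yL; have [xa xc] := skew_cent_adapted xL; have [ya yc] := skew_cent_adapted yL.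
have [xya xyc] := comp_adapted xL ya yc; have [yxa yxc] := comp_adapted yL xa xc.
have zE k1 k2 k3 v1 v2 v3 :
    z (k1 *: v1 - k2 *: v2 - k3 *: v3) = k1 *: z v1 - k2 *: z v2 - k3 *: z v3.
  by rewrite !linearB !linearZ.
rewrite /gl_entry !big_ord_recl !big_ord0 /= !(add_lfunE, opp_lfunE, comp_lfunE).
rewrite xya xyc yxa yxc {xya xyc yxa yxc}.
move: xa xc ya yc; move: (g (x a) _) (g (x a) _) (g (x a) _) (g (x c) _) => p q r s.
move: (g (y a) _) (g (y a) _) (g (y a) _) (g (y c) _) => p' q' r' s'.
move: (x a) (x c) (y a) (y c) => xa xc ya yc -> -> -> ->.
rewrite !zE !zz0 !gE !E !iso.
by do 2!case: ifP => _; ring.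
Qed.

Lemma gl_entry_inj x : skew_cent x -> (forall i j, gl_entry i j x = 0) -> x = 0.
Proof.
move=> xL x0; have [xa xc] := skew_cent_adapted xL.
move: (x0 0 0) (x0 0 1) (x0 1 0) (x0 1 1); rewrite /gl_entry /=.
move: (g (x a) _) (g (x a) _) (g (x a) _) (g (x c) _) xa xc => p q r s xa xc.
move=> rp s0 /eqP; rewrite oppr_eq0 => /eqP q0 r'p.
have p0 : p = 0.
  apply: (mulfI two_neq0); rewrite mulr0.
  have -> : 2%:R * p = - ((- p + r) + (- p - r)) by ring.
  by rewrite rp r'p addr0 oppr0.
have r0 : r = 0 by rewrite p0 oppr0 add0r in rp.
rewrite s0 p0 q0 r0 !scale0r !subr0 in xa xc.
apply/lfunP => v; rewrite (span_ac v) zero_lfunE /adapted_proj.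
have [_ xz] := xL.
by rewrite linearD !linearB !linearZ /= !xz xa xc !(linear0 z) !oppr0 !scaler0 !addr0.
Qed.

(** The operator commuting with [z] that maps [a] to [va] and [c] to [vc]. *)
Definition adapted_opf va vc v :=
  g v (z c) *: va - g v (z a) *: vc - g v c *: z va + g v a *: z vc.

Fact adapted_opf_linear va vc : linear (adapted_opf va vc).
Proof.
move=> k v w; rewrite /adapted_opf !gE !scalerDl -!scalerA scalerDr !scalerBr.
by rewrite !opprD; do 3!(rewrite [RHS]addrACA; congr (_ + _)).
Qed.
HB.instance Definition _ va vc :=
  GRing.isLinear.Build F V V _ (adapted_opf va vc) (adapted_opf_linear va vc).

Lemma gl_entry_surj (M : 'M[F]_2) :
  exists2 x, skew_cent x & forall i j, gl_entry i j x = M i j.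
Proof.
pose p := (M 0 0 - M 1 1) / 2%:R; pose r := (M 0 0 + M 1 1) / 2%:R.
pose va := p *: a + M 1 0 *: c + r *: z a; pose vc := M 0 1 *: a - p *: c + r *: z c.
have xE v : linfun (adapted_opf va vc) v = adapted_opf va vc v by rewrite lfunE.
have zE k1 k2 k3 v1 v2 v3 :
    z (k1 *: v1 + k2 *: v2 + k3 *: v3) = k1 *: z v1 + k2 *: z v2 + k3 *: z v3.
  by rewrite !linearD !linearZ.
have zva : z va = p *: z a + M 1 0 *: z c by rewrite /va zE zz0 scaler0 addr0.
have zvc : z vc = M 0 1 *: z a - p *: z c.
  by rewrite /vc -scaleNr zE zz0 scaler0 addr0 scaleNr.
have zE4 k1 k2 k3 k4 v1 v2 v3 v4 :
    z (k1 *: v1 - k2 *: v2 - k3 *: v3 + k4 *: v4) =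
      k1 *: z v1 - k2 *: z v2 - k3 *: z v3 + k4 *: z v4.
  by rewrite linearD !linearB !linearZ.
have opa : adapted_opf va vc a = va.
  by rewrite /adapted_opf !E !scale0r scale1r !subr0 addr0.
have opc : adapted_opf va vc c = vc.
  by rewrite /adapted_opf !E !scale0r scaleN1r subr0 opprK add0r addr0.
exists (linfun (adapted_opf va vc)).
  split=> [v w|v]; rewrite !xE.
    by rewrite /adapted_opf zva zvc /va /vc !gE !(g_sym _ w); ring.
  rewrite /adapted_opf !iso !scale0r subr0 sub0r !z_skew scaleNr opprK scaleNr.
  by rewrite zE4 !zz0 !scaler0 subr0 addr0.
have ord2 (i : 'I_2) : i = 0 \/ i = 1.
  by case: i => [[|[|//]] ?]; [left|right]; apply: val_inj.
move=> i j; rewrite /gl_entry !xE opa opc /va /vc !gE !E !iso.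
by case: (ord2 i) (ord2 j) => -> [] ->; rewrite /= /p /r; field.
Qed.

End TwoBlocks.
End SkewPair.

(** * Reductivity criteria *)

Section ReductiveCriterion.
Variables (F : fieldType) (L : lieAlgType F).
Implicit Types (x y w : L) (U I : {vspace L}).

HB.instance Definition _ x :=
  GRing.isLinear.Build F L L _ (lie_br x) (lie_br_linr x).

Lemma lie_brC x y : lie_br x y = - lie_br y x.
Proof.
apply/eqP; rewrite -addr_eq0; have := lie_brxx (x + y).
by rewrite linearDl !linearDr /= !lie_brxx add0r addr0 => ->.
Qed.

Lemma lie_abelian_reductive : lie_abelian L -> lie_reductive L.
Proof. by move=> abL I _ _ x y _; apply: abL. Qed.

Lemma lie_ideal_comm I : lie_ideal I -> lie_ideal (lie_comm I I).
Proof.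
move=> idI x y; pose X := (linfun (lie_br x) @^-1: lie_comm I I)%VS.
have: (lie_comm I I <= X)%VS.
  apply: lie_comm_min => u v uI vI; rewrite -memv_preim lfunE /=.
  have -> : lie_br x (lie_br u v) = lie_br (lie_br x u) v + lie_br u (lie_br x v).
    have /eqP := lie_jacobi x u v; rewrite -addrA addr_eq0 => /eqP ->.
    rewrite (lie_brC v x) linearNr opprD opprK addrC; congr (_ + _).
    by rewrite [RHS]lie_brC.
  by rewrite memvD // mem_lie_comm // idI.
by move/subvP=> sX /sX; rewrite -memv_preim lfunE.
Qed.

Lemma lie_ideal_derived k I : lie_ideal I -> lie_ideal (lie_derived k I).
Proof. by move=> idI; elim: k => //= k IHk; apply: lie_ideal_comm. Qed.

(** Climb up the derived series of a solvable ideal: if one term is central,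
then [(ad x) ^ 2] takes central values for each [x] in the preceding term. *)
Lemma reductive_criterion :
    (forall x, (forall y w, lie_br w (lie_br x (lie_br x y)) = 0) ->
      forall y, lie_br x y = 0) ->
  lie_reductive L.
Proof.
move=> crit I idI [k Dk]; have: lie_central (lie_derived k I).
  by move=> x y; rewrite Dk memv0 => /eqP->; rewrite linear0r.
elim: k {Dk} => //= k IHk central; apply: IHk => w x xD.
rewrite lie_brC crit ?oppr0 // => y w'; apply: central.
apply: mem_lie_comm => //; rewrite lie_brC memvN.
exact: lie_ideal_derived.
Qed.

End ReductiveCriterion.

(** ** Faithful matrix representations *)

Section MatrixRep.
Variables (E : fieldType) (L : lieAlgType E) (n : nat).
Variable phi : {linear L -> 'M[E]_n}.
Hypothesis two_neq0 : 2%:R != 0 :> E.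
Hypothesis phi_br : forall x y, phi (lie_br x y) = phi x *m phi y - phi y *m phi x.
Hypothesis phi_inj : forall x, phi x = 0 -> x = 0.

Lemma rep_commute x y : phi x *m phi y = phi y *m phi x -> lie_br x y = 0.
Proof. by move=> xy; apply: phi_inj; rewrite phi_br xy subrr. Qed.

Lemma rep_central x y : lie_br x y = 0 -> phi x *m phi y = phi y *m phi x.
Proof. by move=> xy; apply/eqP; rewrite -subr_eq0 -phi_br xy linear0. Qed.

Lemma rep_ad2 x y (X := phi x) (Y := phi y) :
  phi (lie_br x (lie_br x y)) =
    X *m X *m Y - (X *m Y *m X) *+ 2 + Y *m X *m X.
Proof.
rewrite !phi_br mulmxBr mulmxBl !mulmxA opprB addrA mulr2n opprD !addrA.
by rewrite -!addrA; congr (_ + (_ + _)); rewrite addrC.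
Qed.

(** ** Orthogonal Lie algebras *)

Section Orthogonal.
Variable d : 'I_n -> E.
Hypothesis d_neq0 : forall i, d i != 0.
Hypothesis phi_skew : forall x i j, d i * phi x i j = - (d j * phi x j i).

(** The rotation [e_i /\ e_j] for the diagonal form with entries [d], divided by
[d i * d j]; it spares the coefficients [d] in the lemmas on products. *)
Definition skew_unit (i j : 'I_n) : 'M[E]_n :=
  \matrix_(k, l) ((d k)^-1 * (((k == i) && (l == j))%:R - ((k == j) && (l == i))%:R)).

Hypothesis phi_surj : forall i j, exists x, phi x = skew_unit i j.

Lemma mul_skew_unitr (X : 'M[E]_n) i j a b : (X *m skew_unit i j) a b =
  X a i / d i * (b == j)%:R - X a j / d j * (b == i)%:R.
Proof.
rewrite mxE; under eq_bigr => k _ do rewrite mxE 2!mulrBr.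
rewrite sumrB; congr (_ - _).
  rewrite (bigD1 i) //= eqxx /= big1 ?addr0 ?mulrA // => k /negPf ->.
  by rewrite !mulr0.
rewrite (bigD1 j) //= eqxx /= big1 ?addr0 ?mulrA // => k /negPf ->.
by rewrite !mulr0.
Qed.

Lemma mul_skew_unitl (X : 'M[E]_n) i j a b : (skew_unit i j *m X) a b =
  (d a)^-1 * ((a == i)%:R * X j b - (a == j)%:R * X i b).
Proof.
rewrite mxE; under eq_bigr => k _ do rewrite mxE -mulrA mulrBl.
rewrite -mulr_sumr sumrB; congr (_ * (_ - _)).
  rewrite (bigD1 j) //= eqxx andbT big1 ?addr0 // => k /negPf ->.
  by rewrite andbF mul0r.
rewrite (bigD1 i) //= eqxx andbT big1 ?addr0 // => k /negPf ->.
by rewrite andbF mul0r.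
Qed.

Lemma mul_skew_unit_mid (X Y : 'M[E]_n) i j a b : (X *m skew_unit i j *m Y) a b =
  X a i / d i * Y j b - X a j / d j * Y i b.
Proof.
rewrite mxE; under eq_bigr => k _ do rewrite mul_skew_unitr mulrBl.
rewrite sumrB; congr (_ - _).
  rewrite (bigD1 j) //= eqxx mulr1 big1 ?addr0 // => k /negPf ->.
  by rewrite mulr0 mul0r.
rewrite (bigD1 i) //= eqxx mulr1 big1 ?addr0 // => k /negPf ->.
by rewrite mulr0 mul0r.
Qed.

Let c i := (d i)^-1.
Let gram x i j := d i * phi x i j.

Let phi_gram x i j : phi x i j = c i * gram x i j.
Proof. by rewrite /gram /c mulKf. Qed.

Let gramC x i j : gram x i j = - gram x j i.
Proof. exact: phi_skew. Qed.

Let gram0 x i : gram x i i = 0.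
Proof.
apply: (mulfI two_neq0); rewrite mulr0 mulr_natl mulr2n.
by rewrite {1}gramC addNr.
Qed.

Let c_neq0 i : c i != 0. Proof. by rewrite invr_eq0. Qed.

Let two_eq0 (k : E) : k = - k -> k = 0.
Proof. by move=> kN; apply: (mulfI two_neq0);
  rewrite mulr0 mulr_natl mulr2n {1}kN addNr. Qed.

(** In dimension at most 2 the skew matrices form at most a line. *)
Lemma small_abelian (p q : 'I_n) : (forall r, (r == p) || (r == q)) -> lie_abelian L.
Proof.
move=> pq x y; apply: rep_commute; apply/matrixP => i j; rewrite !mxE.
apply: eq_bigr => k _; rewrite !phi_gram.
have [<-|ij] := eqVneq i j; first by rewrite (gramC x k) (gramC y k); ring.
have : (k == i) || (k == j).
  move: (pq i) (pq j) (pq k) ij.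
  do 3!case/orP => /eqP->; rewrite ?eqxx ?orbT //.
by case/orP => /eqP->; rewrite !gram0; ring.
Qed.

Hypothesis three : forall p q : 'I_n, exists r : 'I_n, (r != p) && (r != q).

Lemma orthogonal_center (x : L) : (forall w, lie_br w x = 0) -> x = 0.
Proof.
move=> xZ; apply: phi_inj; apply/matrixP => a i; rewrite [RHS]mxE.
have [->|ai] := eqVneq a i; first by rewrite phi_gram gram0 mulr0.
have [j /andP[ja ji]] := three a i; have [e phi_e] := phi_surj i j.
have /matrixP/(_ a j) := rep_central (xZ e).
rewrite phi_e mul_skew_unitr mul_skew_unitl eqxx.
rewrite (negPf ji) (negPf ai) (eq_sym a) (negPf ja) !mul0r subrr !mulr0 subr0 mulr1.
by move/esym/eqP; rewrite mulf_eq0 invr_eq0 (negPf (d_neq0 i)) orbF => /eqP.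
Qed.

(** Let [y] be the skew matrix [gram x]. The entries of [(ad x) ^ 2 e = 0], for
[e] a skew matrix unit, first say that [y a b * y i j = 0] for distinct indices,
then that [y i j * y i b = 0]. So only one entry of [y] and its transpose can be
nonzero, and the entry [(p, r)] of [(ad x) ^ 2 (e_p /\ e_r)] shows that its
square vanishes. *)
Lemma orthogonal_ad2 (x : L) :
  (forall y, lie_br x (lie_br x y) = 0) -> x = 0.
Proof.
move=> x2; set X := phi x; pose S := X *m X.
have ad2 i j a b : S a i * c i * (b == j)%:R - S a j * c j * (b == i)%:R
    - 2%:R * (X a i * c i * X j b - X a j * c j * X i b)
    + c a * ((a == i)%:R * S j b - (a == j)%:R * S i b) = 0.
  have [e phi_e] := phi_surj i j; have := rep_ad2 x e.
  rewrite /= x2 linear0 phi_e -/X -[skew_unit i j *m X *m X]mulmxA -/S.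
  have entry (A B C : 'M[E]_n) : (A - B *+ 2 + C) a b = A a b - 2%:R * B a b + C a b.
    by rewrite !mxE mulr_natl.
  move/matrixP/(_ a b); rewrite mxE entry => ->.
  by rewrite mul_skew_unitr mul_skew_unitl mul_skew_unit_mid.
have sq_gram j b : S j b = - (c j * \sum_k c k * gram x k j * gram x k b).
  rewrite mxE mulr_sumr -sumrN; apply: eq_bigr => k _.
  by rewrite /X !phi_gram (gramC x j k); ring.
have rc (i j : 'I_n) : i != j -> j != i by rewrite eq_sym.
(* Of the three pairings of four distinct indices, each product equals the next
   up to sign, and the signs multiply to -1. *)
have disjoint a b i j : a != b -> i != j -> a != i -> a != j -> b != i -> b != j ->
    gram x a b * gram x i j = 0.
  have minor p q r s : p != r -> p != s -> q != r -> q != s ->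
      gram x p r * gram x s q = gram x p s * gram x r q.
    move=> /negPf pr /negPf ps /negPf qr /negPf qs; have := ad2 r s p q.
    rewrite pr ps qr qs !mulr0 !mul0r !subrr mulr0 addr0 sub0r.
    move/eqP; rewrite oppr_eq0 mulf_eq0 (negPf two_neq0) subr_eq0 => /eqP.
    rewrite /X !phi_gram => e; have c3 : c p * c r * c s != 0 by rewrite !mulf_neq0.
    by apply: (mulfI c3); apply: etrans (etrans _ e) _; ring.
  move=> ab ij ai aj bi bj; apply: two_eq0.
  have A_B := minor a j b i ab ai (rc _ _ bj) (rc _ _ ij).
  have B_C := minor a b i j ai aj bi bj.
  have C_A := minor a i b j ab aj (rc _ _ bi) ij.
  by rewrite {1}A_B -[RHS]mulrN -(gramC x j i) C_A (gramC x b i) mulrN -B_C (gramC x b j)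
    mulrN.
have share i j b : i != j -> i != b -> j != b -> gram x i j * gram x i b = 0.
  move=> ij ib jb; pose t k := c k * gram x k j * gram x k b.
  have sum_t k : k != j -> k != b -> \sum_l t l = 2%:R * t k.
    move=> kj kb; have := ad2 k j k b; rewrite eqxx.
    rewrite (eq_sym b j) (negPf jb) (eq_sym b k) (negPf kb) (negPf kj).
    rewrite /X !phi_gram gram0 (sq_gram j b) => e.
    have c2 : c k * c j != 0 by rewrite mulf_neq0.
    apply: (mulfI c2); apply/eqP; rewrite -subr_eq0; apply/eqP.
    by rewrite -[RHS]oppr0 -[0 in RHS]e /t /=; ring.
  suff : t i = 0.
    move/eqP; rewrite /t -mulrA mulf_eq0 (negPf (c_neq0 i)) => /eqP.
    by [].
  have [k /and3P[ki kj kb]|none] := pickP (fun k => [&& k != i, k != j & k != b]).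
    (* [t] takes the same value at all such indices, and [t i * t k]
       contains a product of entries with disjoint indices. *)
    have tik : t i = t k by apply: (mulfI two_neq0); rewrite -!sum_t.
    have /eqP : t i * t i = 0.
      rewrite {2}tik /t; have dis : gram x i j * gram x k b = 0.
        by apply: disjoint => //; rewrite ?(eq_sym _ k).
      transitivity (c i * gram x i b * c k * gram x k j * (gram x i j * gram x k b)).
        by ring.
      by rewrite dis mulr0.
    by rewrite mulf_eq0 orbb => /eqP.
  have := sum_t i ij ib; rewrite (bigD1 i) //= big1 ?addr0 => [t2|k ki].
    by apply: (addrI (t i)); rewrite addr0 [RHS]t2 mulr_natl mulr2n.
  have := none k; rewrite ki /=; case: eqP => [->|_];
    first by rewrite /t gram0 mulr0 mul0r.
  by case: eqP => [->|//]; rewrite /t gram0 mulr0.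
apply: phi_inj; apply/matrixP => p q; rewrite [RHS]mxE phi_gram.
have [->|gpq] := eqVneq (gram x p q) 0; first by rewrite mulr0.
have pq : p != q by apply: contraNneq gpq => ->; rewrite gram0.
have [r /andP[rp rq]] := three p q.
have gp k : k != q -> gram x p k = 0.
  move=> kq; have [->|kp] := eqVneq k p; first exact: gram0.
  have /eqP := share p q k pq (rc _ _ kp) (rc _ _ kq).
  by rewrite mulf_eq0 (negPf gpq) => /eqP.
have gr k : gram x k r = 0.
  have [->|kr] := eqVneq k r; first exact: gram0.
  have [->|kp] := eqVneq k p; first exact: gp.
  have [->|kq] := eqVneq k q.
    have /eqP := share q p r (rc _ _ pq) (rc _ _ rq) (rc _ _ rp).
    by rewrite mulf_eq0 gramC oppr_eq0 (negPf gpq) => /eqP.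
  have /eqP := disjoint p q k r pq kr (rc _ _ kp) (rc _ _ rp) (rc _ _ kq) (rc _ _ rq).
  by rewrite mulf_eq0 (negPf gpq) => /eqP.
have := ad2 p r p r; rewrite !eqxx (negPf rp) (eq_sym p r) (negPf rp).
rewrite /X !phi_gram gram0 !gr !sq_gram [in X in _ + X]big1 => [|k _]; last first.
  by rewrite gr mulr0.
rewrite (bigD1 q) //= big1 => [|k kq]; last by rewrite (gramC x k) gp // oppr0 mulr0.
move=> e; have prod0 : c p * c p * c q * (gram x q p * gram x q p) = 0.
  by rewrite -[RHS]oppr0 -[0 in RHS]e /=; ring.
have gqp : gram x q p != 0 by rewrite gramC oppr_eq0.
have c3 : c p * c p * c q != 0 by rewrite !mulf_neq0.
by have := mulf_neq0 c3 (mulf_neq0 gqp gqp); rewrite prod0 eqxx.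
Qed.

End Orthogonal.

(** From three dimensions on, the center is zero and so is every [x] with
[(ad x) ^ 2 = 0]. *)
Lemma orthogonal_reductive (d : 'I_n -> E) :
    (forall i, d i != 0) ->
    (forall x i j, d i * phi x i j = - (d j * phi x j i)) ->
    (forall i j, exists x, phi x = skew_unit d i j) ->
  lie_reductive L.
Proof.
move=> d_neq0 phi_skew phi_surj.
have [/'forall_forallP three|] :=
    boolP [forall p : 'I_n, forall q : 'I_n, exists r : 'I_n, (r != p) && (r != q)].
  have {}three (p q : 'I_n) : exists r : 'I_n, (r != p) && (r != q).
    by apply/existsP/three.
  apply: reductive_criterion => x x2 y.
  rewrite [x](orthogonal_ad2 d_neq0) ?linear0l // => y'.
  by apply: (orthogonal_center d_neq0) => // w; apply: x2.
move=> /forallPn[p /forallPn[q /existsPn two]]; apply: lie_abelian_reductive.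
apply: (small_abelian d_neq0 phi_skew (p := p) (q := q)) => r.
by have := two r; rewrite negb_and !negbK.
Qed.

End MatrixRep.

(** ** The general linear Lie algebra of rank 2 *)

(** If [(ad x) ^ 2] has scalar values, its values at the two off-diagonal matrix
units show that [x] is scalar. *)
Lemma gl2_reductive (E : fieldType) (L : lieAlgType E) (phi : {linear L -> 'M[E]_2}) :
    2%:R != 0 :> E ->
    (forall x y, phi (lie_br x y) = phi x *m phi y - phi y *m phi x) ->
    (forall x, phi x = 0 -> x = 0) ->
    (forall i j, exists x, phi x = delta_mx i j) ->
  lie_reductive L.
Proof.
move=> two_neq0 phi_br phi_inj phi_surj; apply: reductive_criterion => x x2 y.
have central_offdiag t : (forall w, lie_br w t = 0) -> phi t 0 1 = 0 /\ phi t 1 0 = 0.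
  move=> tZ; have [e phi_e] := phi_surj 0 0.
  have := rep_central phi_br (tZ e); rewrite phi_e => /matrixP comm_e.
  move: (comm_e 0 1) (comm_e 1 0).
  by rewrite !mxE !big_ord_recl !big_ord0 !mxE /= !(mul0r, mul1r, mulr0, mulr1, addr0,
    add0r).
have ord_lift : lift ord0 ord0 = 1 :> 'I_2 by apply: val_inj.
have mulE (A B : 'M[E]_2) i j : (A *m B) i j = A i 0 * B 0 j + A i 1 * B 1 j.
  by rewrite mxE !big_ord_recl big_ord0 addr0 ord_lift.
have subE (A B : 'M[E]_2) i j : (A - B) i j = A i j - B i j by rewrite !mxE.
have deltaE (k l i j : 'I_2) : (delta_mx k l : 'M[E]_2) i j = ((i == k) && (j == l))%:R.
  by rewrite mxE.
have [e phi_e] := phi_surj 0 1; have [e' phi_e'] := phi_surj 1 0.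
have [te1 te2] := central_offdiag _ (fun w => x2 e w).
have [te1' te2'] := central_offdiag _ (fun w => x2 e' w).
move: te1 te2 te1' te2'; rewrite !phi_br phi_e phi_e' !(mulE, subE).
rewrite !deltaE /=; set a := phi x 0 0; set b := phi x 0 1.
set c := phi x 1 0; set d := phi x 1 1 => te1 te2 te1' te2'.
have c0 : c = 0.
  have /eqP : c * c = 0.
    apply: (mulfI two_neq0); rewrite mulr0 -[RHS]oppr0 -[0 in RHS]te2; ring.
  by rewrite mulf_eq0 orbb => /eqP.
have b0 : b = 0.
  have /eqP : b * b = 0.
    apply: (mulfI two_neq0); rewrite mulr0 -[RHS]oppr0 -[0 in RHS]te1'; ring.
  by rewrite mulf_eq0 orbb => /eqP.
have da : d = a.
  apply/eqP; rewrite -subr_eq0; have /eqP : (d - a) * (d - a) = 0.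
    by rewrite -te1 b0 c0; ring.
  by rewrite mulf_eq0 orbb.
apply: (rep_commute phi_br phi_inj); apply/matrixP.
have ord2 (i : 'I_2) : i = 0 \/ i = 1.
  by case: i => [[|[|//]] ?]; [left|right]; apply: val_inj.
by move=> i j; rewrite !mulE; case: (ord2 i) (ord2 j) => -> [] ->;
  rewrite -/a -/b -/c -/d ?b0 ?c0 ?da; ring.
Qed.

(** ** Representations and extension of scalars *)

Section ExtendRep.
Variables (F K : fieldType) (iota : {rmorphism F -> K}) (L : lieAlgType F) (n : nat).
Variable phi : {linear L -> 'M[F]_n}.
Hypothesis phi_br : forall x y, phi (lie_br x y) = phi x *m phi y - phi y *m phi x.
Hypothesis phi_inj : forall x, phi x = 0 -> x = 0.
Local Notation LK := (lie_ext iota L).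
Local Notation e := (vbasis {:L}).

(** The [K]-linear extension of [phi], in the coordinates by which the extension
of scalars is defined. *)
Definition ext_rep (y : LK) : 'M[K]_n :=
  \sum_(i < \dim {:L}) y 0 i *: map_mx iota (phi e`_i).

Fact ext_rep_linear : linear ext_rep.
Proof.
move=> k x y; rewrite /ext_rep scaler_sumr -big_split; apply: eq_bigr => i _ /=.
by rewrite !mxE scalerDl scalerA.
Qed.
HB.instance Definition _ := GRing.isLinear.Build K LK 'M[K]_n _ ext_rep ext_rep_linear.

Lemma ext_rep_in x : ext_rep (lie_ext_in iota x) = map_mx iota (phi x).
Proof.
rewrite {2}(coord_vbasis (memvf x)) linear_sum map_mx_sum; apply: eq_bigr => i _.
by rewrite linearZ /= map_mxZ mxE.
Qed.

Lemma ext_rep_br x y :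
  ext_rep (lie_br x y) = ext_rep x *m ext_rep y - ext_rep y *m ext_rep x.
Proof.
have ext_repZ k v : ext_rep (k *: v) = k *: ext_rep v by exact: linearZ.
have br_in u v : ext_rep (lie_br (lie_ext_in iota u) (lie_ext_in iota v)) =
    ext_rep (lie_ext_in iota u) *m ext_rep (lie_ext_in iota v) -
    ext_rep (lie_ext_in iota v) *m ext_rep (lie_ext_in iota u).
  rewrite [lie_br _ _]lie_ext_br_in !ext_rep_in phi_br.
  by rewrite map_mxB !map_mxM.
have br_inr v : ext_rep (lie_br x (lie_ext_in iota v)) =
    ext_rep x *m ext_rep (lie_ext_in iota v) - ext_rep (lie_ext_in iota v) *m ext_rep x.
  rewrite [x]lie_ext_coord linear_sumlz !(linear_sum ext_rep) mulmx_suml mulmx_sumr.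
  rewrite -sumrB; apply: eq_bigr => i _.
  by rewrite linearZl_LR /= !ext_repZ -scalemxAl -scalemxAr -scalerBr br_in.
rewrite [y]lie_ext_coord linear_sumr !(linear_sum ext_rep).
move: (ext_rep x) br_inr => X br_inr.
rewrite mulmx_suml mulmx_sumr -sumrB; apply: eq_bigr => i _.
by rewrite linearZr_LR /= !ext_repZ -scalemxAl -scalemxAr -scalerBr br_inr.
Qed.

(** Matrices over [F] that are linearly independent over [F] remain so over [K],
since the rank of a matrix does not change. *)
Lemma ext_rep_inj x : ext_rep x = 0 -> x = 0.
Proof.
pose M := \matrix_(i < \dim {:L}) mxvec (phi e`_i).
have M_free : row_free M.
  apply/inj_row_free => v; rewrite mulmx_sum_row => v0.
  have sum0 : \sum_i v 0 i *: e`_i = 0.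
    apply: phi_inj; apply: (can_inj mxvecK); rewrite !linear_sum linear0 -[RHS]v0.
    by apply: eq_bigr => i _; rewrite rowK !linearZ.
  apply/rowP => i; rewrite mxE.
  have /freeP free_e := basis_free (vbasisP {:L}).
  exact: (free_e (fun i => v 0 i) sum0 i).
move=> x0; have MK_free : row_free (map_mx iota M) by rewrite /row_free mxrank_map.
apply: (row_free_inj MK_free); rewrite mul0mx mulmx_sum_row.
apply: (can_inj vec_mxK); rewrite linear0 -[RHS]x0 linear_sum; apply: eq_bigr => i _.
by rewrite linearZ /= -map_row rowK map_mxvec mxvecK.
Qed.

End ExtendRep.

(** * The Lie algebra of a form with unipotent asymmetry *)

Section FormPair.
Variables (F : fieldType) (V : vectType F).
Hypothesis two_neq0 : 2%:R != 0 :> F.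
Variable f : {bilinear V -> V -> F | *%R & *%R}.
Hypothesis f_nondeg : form_nondegenerate f.
Variable sigma : 'End(V).
Hypothesis f_asym : form_asymmetry f sigma.
Hypothesis sigma_unip : end_unipotent sigma.
Implicit Types (x y : 'End(V)) (u v w : V).

Definition symform v w := f v w + f w v.

Fact symform_linl w : linear_for *%R (symform^~ w).
Proof.
move=> k u v; rewrite /symform linearPl linearPr /= mulrDr; ring.
Qed.

Fact symform_linr v : linear_for *%R (symform v).
Proof.
move=> k u w; rewrite /symform linearPl linearPr /= mulrDr; ring.
Qed.

HB.instance Definition _ :=
  bilinear_isBilinear.Build F V V F *%R *%R symform (symform_linl, symform_linr).

Local Notation g := (symform : {bilinear V -> V -> F | *%R & *%R}).

Lemma symform_sym : form_symmetric g.
Proof. by move=> v w; apply: addrC. Qed.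

Lemma asymmetry_isometry v w : f (sigma v) (sigma w) = f v w.
Proof. by rewrite -(f_asym (sigma v)) -f_asym. Qed.

Lemma XB1_sigma_nil : exists k, forall v, end_horner sigma (('X - 1) ^+ k) v = 0.
Proof.
have [k sk] := sigma_unip; exists k => v; rewrite end_horner_expn.
rewrite -(zero_lfunE _ v) -sk end_expE; elim: k {sk} => //= k ->.
by rewrite end_hornerXB1 !(add_lfunE, opp_lfunE) id_lfunE.
Qed.

(** [1 + sigma] is invertible, as [sigma] is unipotent and 2 is a unit; its
inverse is a polynomial in [sigma]. *)
Lemma one_plus_sigma_inv :
  exists a : {poly F}, forall v, end_horner sigma a (v + sigma v) = v.
Proof.
have [k sk] := XB1_sigma_nil.
have : coprimep ('X + 1) (('X - 1) ^+ k : {poly F}).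
  have -> : 'X + 1 = 'X - (- 1)%:P :> {poly F} by rewrite polyCN opprK polyC1.
  rewrite coprimep_expr // -[X in coprimep _ ('X - X)]polyC1 coprimep_XsubC2 //.
  by rewrite opprK -mulr2n.
case/Bezout_eq1_coprimepP=> -[a b] /= ab1; exists a => v.
rewrite -{3}[v](end_horner1 sigma) -ab1 end_hornerD !end_hornerM sk linear0 addr0.
by rewrite end_hornerD end_hornerX end_horner1 addrC.
Qed.

(** The asymmetry is determined by [f], so it commutes with everything that
preserves [f], even infinitesimally. *)
Lemma form_skew_asym x : (forall v w, f (x v) w = - f v (x w)) ->
  forall v, x (sigma v) = sigma (x v).
Proof.
move=> xs v; apply/eqP; rewrite -subr_eq0; apply/eqP/f_nondeg.2 => w.
rewrite linearBr /= -f_asym -[f w (x _)]opprK -xs -f_asym xs; ring.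
Qed.

Section Cayley.
Variable a : {poly F}.
Hypothesis a_inv : forall v, end_horner sigma a (v + sigma v) = v.

(** The Cayley transform of the asymmetry. The symmetric part of [f] is half of
[symform], and its alternating part is half of [- symform v (cayley w)]; so an
operator is skew for [f] when it is skew for [symform] and commutes with
[cayley]. *)
Definition cayley : 'End(V) := end_horner sigma (('X - 1) * a).
Local Notation z := cayley.

Lemma plus_sigma_surj v : exists w, v = w + sigma w.
Proof.
exists (end_horner sigma a v); rewrite -{1}[v]a_inv linearD /=.
by rewrite (end_horner_comm (x := sigma)).
Qed.

Lemma cayleyE v : z (v + sigma v) = sigma v - v.
Proof. by rewrite /z end_hornerM a_inv end_hornerXB1. Qed.

Lemma cayley_nil : exists k, forall v, iter k z v = 0.
Proof.
have [k sk] := XB1_sigma_nil; exists k => v.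
by rewrite -end_horner_expn exprMn mulrC end_hornerM sk linear0.
Qed.

Lemma symformE v w : g v w = f v (w + sigma w).
Proof. by rewrite linearDr /= -f_asym. Qed.

Lemma symform_nondeg v : (forall w, g v w = 0) -> v = 0.
Proof.
move=> gv; apply: f_nondeg.1 => w; have [w' ->] := plus_sigma_surj w.
by rewrite -symformE gv.
Qed.

Lemma cayley_skew v w : g (z v) w = - g v (z w).
Proof.
have [v' ->] := plus_sigma_surj v; have [w' ->] := plus_sigma_surj w.
rewrite !cayleyE !(linearDl, linearDr, linearNl, linearNr) /=.
rewrite /symform !asymmetry_isometry; ring.
Qed.

Lemma cayley_comm x : (forall v, x (sigma v) = sigma (x v)) ->
  forall v, x (z v) = z (x v).
Proof. by move=> xs v; rewrite (end_horner_comm (x := x)). Qed.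

Lemma form_skew_centP x : x \in form_skew f <-> skew_cent g z x.
Proof.
split=> [/form_skewP xs|[xg xz]].
  split; last exact/cayley_comm/form_skew_asym.
  by move=> v w; rewrite /= /symform xs (xs w); ring.
apply/form_skewP => v w; apply: (mulfI two_neq0).
have fE v' w' : 2%:R * f v' w' = g v' w' - g v' (z w').
  have -> : g v' (z w') = f v' (sigma w' - w').
    by rewrite symformE (cayley_comm (x := sigma)) // -linearD /= cayleyE.
  by rewrite linearBr /= -f_asym /= /symform; ring.
by rewrite mulrN !fE xg -xz xg; ring.
Qed.

(** ** A nilpotent ideal of the Lie algebra of a form *)

Local Notation L := (form_lie f).
Local Notation M := (lker z).
Local Notation W := (limg z + lker z)%VS.

(** The operator [maps_intof U T x] vanishes exactly when [x] maps [U] into [T];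
it is linear in [x], so this condition defines a subspace. *)
Definition maps_intof (U T : {vspace V}) (x : L) : 'End(V) :=
  ((\1 - projv T) \o (vsval x \o projv U))%VF.

Fact maps_into_linear U T : linear (maps_intof U T).
Proof.
move=> k x y; rewrite /maps_intof linearP /=; move: (\1 - _)%VF => P.
apply/lfunP => v; rewrite !(comp_lfunE, add_lfunE, scale_lfunE).
by rewrite linearP.
Qed.
HB.instance Definition _ U T :=
  GRing.isLinear.Build F L 'End(V) _ (maps_intof U T) (maps_into_linear U T).

Definition maps_into U T : {vspace L} := lker (linfun (maps_intof U T)).

Lemma maps_intoP (U T : {vspace V}) (x : L) :
  reflect (forall u, u \in U -> vsval x u \in T) (x \in maps_into U T).
Proof.
rewrite memv_ker lfunE /=; apply: (iffP eqP) => [x0 u uU|xUT].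
  have := congr1 (fun y : 'End(V) => y u) x0.
  rewrite zero_lfunE !comp_lfunE projv_id // add_lfunE opp_lfunE id_lfunE => /eqP;
    rewrite subr_eq0 => /eqP ->.
  exact: memv_proj.
apply/lfunP => v; rewrite zero_lfunE !comp_lfunE add_lfunE opp_lfunE id_lfunE.
by rewrite [projv T _]projv_id ?subrr // xUT // memv_proj.
Qed.

Definition nil_ideal : {vspace L} :=
  (maps_into fullv W :&: maps_into M (limg z))%VS.

Lemma lie_br_val (x y : L) v :
  vsval (lie_br x y) v = vsval x (vsval y v) - vsval y (vsval x v).
Proof. by rewrite [lie_br x y]/(form_lie_br x y) form_lie_brE add_lfunE opp_lfunE
  !comp_lfunE. Qed.

Lemma form_lie_comm (x : L) v : vsval x (z v) = z (vsval x v).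
Proof. by have /form_skew_centP[_ ->] := subvsP x. Qed.

Lemma nil_idealP (x : L) :
  reflect ((forall v, vsval x v \in W) /\ (forall v, z v = 0 -> vsval x v \in limg z))
    (x \in nil_ideal).
Proof.
rewrite memv_cap; apply: (iffP andP) => [[/maps_intoP xW /maps_intoP xM]|[xW xM]].
  by split=> [v|v zv]; [rewrite xW ?memvf | rewrite xM // memv_ker zv].
split; apply/maps_intoP => u; first by rewrite xW.
by rewrite memv_ker => /eqP /xM.
Qed.

Lemma nil_ideal_ideal : lie_ideal nil_ideal.
Proof.
move=> x y /nil_idealP[yW yM]; apply/nil_idealP; split=> [v|v zv].
  rewrite lie_br_val memvB //; have /memv_addP[_ /memv_imgP[w _ ->] [m mM ->]] := yW v.
  rewrite linearD /= form_lie_comm memv_add ?memv_img ?memvf //.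
  move: mM; rewrite !memv_ker -form_lie_comm => /eqP->; rewrite linear0 //.
rewrite lie_br_val memvB //; last by rewrite yM // -form_lie_comm zv linear0.
by have /memv_imgP[w _ ->] := yM v zv; rewrite form_lie_comm memv_img ?memvf.
Qed.

(** The product of two elements of the ideal maps [V] into [z V], and an element
that maps [V] into [z ^ j V] commutes with [z], so that the product of two such
maps [V] into [z ^ (2 j) V]: each derivation gains at least one factor [z]. *)
Lemma nil_ideal_solvable : lie_solvable nil_ideal.
Proof.
have [k zk] := cayley_nil; exists k.+1; apply/eqP; rewrite -subv0.
suff deriv j : (lie_derived j.+1 nil_ideal <= maps_into fullv (limg (end_exp z j.+1)))%VS.
  apply: subv_trans (deriv k) _; apply/subvP=> x /maps_intoP xk; rewrite memv0.
  apply/eqP/val_inj/lfunP => v; rewrite zero_lfunE.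
  have /memv_imgP[w _ ->] := xk v (memvf v).
  by rewrite end_expE iterS zk linear0.
have comm_iter (x : L) i v : vsval x (iter i z v) = iter i z (vsval x v).
  by elim: i => //= i <-; rewrite form_lie_comm.
elim: j => [|j IHj]; apply: lie_comm_min => x y.
  have img (x' y' : L) v : x' \in nil_ideal -> y' \in nil_ideal ->
      vsval x' (vsval y' v) \in limg z.
    move=> /nil_idealP[_ xM] /nil_idealP[yW _].
    have /memv_addP[_ /memv_imgP[w _ ->] [m mM ->]] := yW v.
    rewrite linearD /= form_lie_comm memvD ?memv_img ?memvf //.
    by apply: xM; apply/eqP; rewrite -memv_ker.
  move=> xI yI; apply/maps_intoP => v _; rewrite lie_br_val /end_exp /= comp_lfun1r.
  by rewrite memvB // img.
have img (x' y' : L) v : x' \in lie_derived j.+1 nil_ideal ->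
    y' \in lie_derived j.+1 nil_ideal -> vsval x' (vsval y' v) \in limg (end_exp z j.+2).
  move=> /(subvP IHj)/maps_intoP xj /(subvP IHj)/maps_intoP yj.
  have /memv_imgP[w _ ->] := yj v (memvf v); rewrite end_expE comm_iter.
  have /memv_imgP[w' _ ->] := xj w (memvf w).
  rewrite end_expE -iterD addSnnS addnC iterD -end_expE memv_img ?memvf //.
by move=> xI yI; apply/maps_intoP => v _; rewrite lie_br_val memvB // img.
Qed.

Lemma reductive_nil_central : lie_reductive L ->
  forall x y, skew_cent g z x -> skew_cent g z y ->
  (forall v, x v \in W) -> (forall v, z v = 0 -> x v \in limg z) ->
  forall v, x (y v) = y (x v).
Proof.
move=> redL x y /form_skew_centP xL /form_skew_centP yL xW xM v.
pose x' : L := vsproj (form_skew f) x; pose y' : L := vsproj (form_skew f) y.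
have x'E : vsval x' = x by apply: vsprojK.
have y'E : vsval y' = y by apply: vsprojK.
have x'I : x' \in nil_ideal by apply/nil_idealP; rewrite x'E.
have yx0 : lie_br y' x' = 0 := redL _ nil_ideal_ideal nil_ideal_solvable _ _ x'I.
have := lie_br_val y' x' v; rewrite yx0 zero_lfunE x'E y'E => /esym/eqP.
by rewrite subr_eq0 => /eqP.
Qed.

End Cayley.

(** ** Module generators and elementary divisors *)

Local Notation N v := (sigma v - v).

Lemma form_lie_asym (x : form_lie f) v : vsval x (sigma v) = sigma (vsval x v).
Proof. by move: v; apply: form_skew_asym; apply/form_skewP/subvsP. Qed.

Lemma form_lie_skew (x : form_lie f) v w : f (vsval x v) w = - f v (vsval x w).
Proof. by have /form_skewP := subvsP x. Qed.

Lemma form_lie_horner (x : form_lie f) p v :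
  vsval x (end_horner sigma p v) = end_horner sigma p (vsval x v).
Proof. by rewrite (end_horner_comm (x := vsval x)) // => w; apply: form_lie_asym. Qed.

Lemma form_lie_abelian :
  (forall (x y : form_lie f) v, vsval x (vsval y v) = vsval y (vsval x v)) ->
  lie_abelian (form_lie f).
Proof.
move=> xyC x y; apply/val_inj/lfunP => v.
by rewrite [LHS]lie_br_val xyC subrr zero_lfunE.
Qed.

(** The exponent [k] of [sigma - 1] is at least [dim V], as the characteristic
polynomial divides [('X - 1) ^+ k]. A vector of exact order [k] therefore has
[dim V] independent images under the powers of [sigma]. *)
Lemma cyclic_generator : (0 < \dim {:V})%N -> end_cyclic sigma ->
  exists u, forall v, exists p, v = end_horner sigma p u.
Proof.
move=> dimV [_ min_char]; pose n := \dim {:V}.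
have ex_k : exists k, end_horner sigma (('X - 1) ^+ k) == 0.
  have [k sk] := XB1_sigma_nil; exists k; apply/eqP/lfunP => v.
  by rewrite sk zero_lfunE.
case: (ex_minnP ex_k) => k /eqP sk k_min.
have le_nk : (n <= k)%N.
  have := dvdp_leq _ (iffLR (min_char _) sk); rewrite size_char_poly sizeXB1 ltnS; apply.
  by rewrite -size_poly_eq0 sizeXB1.
case: k sk k_min le_nk => [|k] sk k_min le_nk; first by rewrite leqNgt dimV in le_nk.
have /lfunPn[u] : end_horner sigma (('X - 1) ^+ k) != 0.
  by apply/negP => /k_min; rewrite ltnn.
rewrite zero_lfunE => u_top; exists u => v.
pose X := [tuple iter i sigma u | i < n].
have sumX (c : 'I_n -> F) : \sum_i c i *: X`_i =
    end_horner sigma (\poly_(i < n) (if insub i is Some j then c j else 0)) u.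
  rewrite (end_hornerE _ _ (size_poly _ _)); apply: eq_bigr => i _.
  by rewrite coef_poly ltn_ord insubT // => lt_in; rewrite (nth_mktuple _ _ i) /=;
    congr (c _ *: _); apply: val_inj.
have free_X : free X.
  have sk_u : end_horner sigma (('X - 1) ^+ k.+1) u = 0 by rewrite sk zero_lfunE.
  apply/freeP => c; rewrite sumX.
  move/(iffLR (end_horner_XB1_eq0 _ sk_u u_top)) => dvd i; move: dvd.
  set p := \poly_(_ < _) _ => dvd; have /eqP p0 : p == 0.
    apply: contraTT dvd => p0; apply/negP => /(dvdp_leq p0).
    by rewrite sizeXB1 leqNgt ltnS (leq_trans (size_poly _ _)).
  have := congr1 (fun q : {poly F} => q`_i) p0; rewrite coef0 coef_poly ltn_ord insubT //.
  by move=> lt_in <-; congr c; apply: val_inj.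
have X_basis : basis_of {:V} X by rewrite basisEfree free_X subvf size_tuple leqnn.
by rewrite (coord_basis X_basis (memvf v)) sumX; eexists.
Qed.

Lemma cyclic_abelian : (0 < \dim {:V})%N -> end_cyclic sigma ->
  lie_abelian (form_lie f).
Proof.
move=> dimV /(cyclic_generator dimV)[u gen]; apply: form_lie_abelian => x y v.
have [p xu] := gen (vsval x u); have [q yu] := gen (vsval y u); have [r ->] := gen v.
rewrite !form_lie_horner yu xu !form_lie_horner xu yu.
by congr (end_horner _ _ _); rewrite -!end_hornerM mulrC.
Qed.

Lemma elementary_divisors2P (p0 p1 : {poly F}) :
  end_elementary_divisors sigma [:: p0; p1] ->
  exists u b,
    (forall v, exists p q, v = end_horner sigma p u + end_horner sigma q b) /\
    (forall p q, end_horner sigma p u + end_horner sigma q b = 0 <->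
       p0 %| p /\ p1 %| q).
Proof.
case=> _ [w [gen rel]]; exists (w ord0), (w (lift ord0 ord0)); split=> [v|p q].
  by have [c ->] := gen v; exists (c ord0), (c (lift ord0 ord0));
    rewrite !big_ord_recl big_ord0 addr0.
pose c (i : 'I_2) := if i == 0 then p else q.
have := rel c; rewrite !big_ord_recl big_ord0 addr0 /= => ->; split=> [dvd|[dp dq] i].
  by split; [apply: (dvd ord0) | apply: (dvd (lift ord0 ord0))].
by case: i => [[|[|//]] ?].
Qed.

Lemma elementary_divisors2I k0 k1 u b :
    (0 < k0)%N -> (0 < k1)%N ->
    (forall v, exists p q, v = end_horner sigma p u + end_horner sigma q b) ->
    (forall p q, end_horner sigma p u + end_horner sigma q b = 0 <->
       ('X - 1) ^+ k0 %| p /\ ('X - 1) ^+ k1 %| q) ->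
  end_elementary_divisors sigma [:: ('X - 1) ^+ k0; ('X - 1) ^+ k1].
Proof.
move=> k0_gt0 k1_gt0 gen rel; split=> [q|].
  have irr : irreducible_poly ('X - 1 : {poly F}).
    by rewrite -polyC1; apply: irredp_XsubC.
  have mon : 'X - 1 \is @monic F by rewrite -polyC1 monicXsubC.
  by rewrite !inE => /orP[]/eqP->; [exists ('X - 1), k0 | exists ('X - 1), k1].
exists (fun i => if i == 0 :> nat then u else b); split=> [v|c].
  have [p [q ->]] := gen v; exists (fun i => if i == 0 :> nat then p else q).
  by rewrite !big_ord_recl big_ord0 addr0.
rewrite !big_ord_recl big_ord0 addr0 /= rel; split=> [[dp dq] i|dvd].
  case: i => [[|[|//]] lt_i].
    by rewrite (_ : Ordinal lt_i = ord0) //; apply: val_inj.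
  by rewrite (_ : Ordinal lt_i = lift ord0 ord0) //; apply: val_inj.
by split; [apply: (dvd ord0) | apply: (dvd (lift ord0 ord0))].
Qed.

Lemma end_horner_at1 p v : exists w, end_horner sigma p v = p.[1] *: v + N w.
Proof.
have [q Dp] := poly_at1 p; exists (end_horner sigma q v).
by rewrite {1}Dp mulrC end_hornerD end_hornerM end_hornerXB1 end_hornerC addrC.
Qed.

Lemma end_horner_fixed p v : N v = 0 -> end_horner sigma p v = p.[1] *: v.
Proof.
move=> Nv; have [q Dp] := poly_at1 p.
by rewrite {1}Dp end_hornerD end_hornerM end_hornerXB1 Nv linear0 add0r end_hornerC.
Qed.

Lemma fixed_perp v m : N m = 0 -> f (N v) m = 0 /\ f m (N v) = 0.
Proof.
move/eqP; rewrite subr_eq0 => /eqP sm; rewrite linearBl linearBr /=.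
by rewrite -{1 3}sm !asymmetry_isometry !subrr.
Qed.

(** [f (w - sigma w) m = 0] for [m] fixed by [sigma], so only the value of [p]
at 1 matters. *)
Lemma end_horner_perp p v m : N m = 0 ->
  f (end_horner sigma p v) m = p.[1] * f v m.
Proof.
move=> Nm; have [w ->] := end_horner_at1 p v; have [Nw _] := fixed_perp w Nm.
by move: (N w) Nw => w' w'm; rewrite linearDl linearZl_LR /= w'm addr0.
Qed.

(** Let [e = (sigma - 1) ^ (k - 1) u], and correct [b] by a multiple of [e] to a
vector [b'] orthogonal to [u]. Each element of the Lie algebra maps [u] to
[p u + beta b'] and [b'] to [gamma e], with [p.[1] = 0], and the form makes
[gamma] the same multiple of [beta] for all elements. So two elements commute on
[u] and on [b']. *)
Lemma hook_abelian k u b : (1 < k)%N ->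
    (forall v, exists p q, v = end_horner sigma p u + end_horner sigma q b) ->
    (forall p q, end_horner sigma p u + end_horner sigma q b = 0 <->
       ('X - 1) ^+ k %| p /\ 'X - 1 %| q) ->
  lie_abelian (form_lie f).
Proof.
case: k => [|[|k]] // _ gen rel.
pose h p v := end_horner sigma p v; pose e := h (('X - 1) ^+ k.+1) u.
have Nb : N b = 0.
  have := iffRL (rel 0 ('X - 1)) (conj (dvdp0 _) (dvdpp _)).
  by rewrite end_horner0 add0r end_hornerXB1.
have hb q : h q b = q.[1] *: b by apply: end_horner_fixed.
have u_nil : h (('X - 1) ^+ k.+2) u = 0.
  have := iffRL (rel (('X - 1) ^+ k.+2) 0) (conj (dvdpp _) (dvdp0 _)).
  by rewrite end_horner0 addr0.
have e_neq0 : e != 0.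
  apply/eqP => e0; have [] := iffLR (rel (('X - 1) ^+ k.+1) 0).
    by rewrite -/(h _ _) -/e e0 end_horner0 addr0.
  by move/dvdp_leq; rewrite !sizeXB1 ltnn -size_poly_eq0 sizeXB1 => /(_ isT).
have ann p : h p u = 0 <-> ('X - 1) ^+ k.+2 %| p by apply: end_horner_XB1_eq0.
have eN : e = N (h (('X - 1) ^+ k) u).
  by rewrite /e exprS /h end_hornerM end_hornerXB1.
have Ne : N e = 0 by rewrite -end_hornerXB1 /e /h -end_hornerM -exprS.
have he p : h p e = p.[1] *: e by apply: end_horner_fixed.
have fe m : N m = 0 -> f e m = 0 /\ f m e = 0.
  by move=> Nm; rewrite eN; apply: fixed_perp.
have hue : f u e != 0.
  apply: contraNneq e_neq0 => ue0; apply/eqP/f_nondeg.2 => v.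
  have [p [q ->]] := gen v; rewrite -/(h q b) hb linearDl linearZl_LR /=.
  by rewrite end_horner_perp // ue0 (fe b Nb).2 !mulr0 addr0.
pose t := f u b / f u e; pose b' := b - t *: e.
have ub' : f u b' = 0 by rewrite /b' /t linearBr linearZr_LR /= divfK ?subrr.
have Nb' : N b' = 0.
  have NB k' v1 v2 : N (v1 - k' *: v2) = N v1 - k' *: N v2.
    rewrite linearB linearZ /= scalerBr !opprB addrACA [RHS]addrACA.
    by congr (_ + _); rewrite addrC.
  by rewrite /b' NB Nb Ne scaler0 subr0.
have hb' q : h q b' = q.[1] *: b' by apply: end_horner_fixed.
have gen' v : exists p beta, v = h p u + beta *: b'.
  have [p [q ->]] := gen v;
  exists (p + (q.[1] * t) *: ('X - 1) ^+ k.+1), q.[1].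
  rewrite /h end_hornerD end_hornerZ -/(h _ _) -/(h _ u) -/e -/(h q b) hb /b'.
  by rewrite scalerBr scalerA -addrA; congr (_ + _); rewrite addrC subrK.
have bb' : f b' b' != 0.
  apply/eqP => bb0; have b'0 : b' = 0.
    apply: f_nondeg.2 => v; have [p [beta ->]] := gen' v.
    by rewrite linearDl linearZl_LR /= end_horner_perp // ub' bb0 !mulr0 addr0.
  have [] := iffLR (rel (- t *: ('X - 1) ^+ k.+1) 1).
    by rewrite end_hornerZ end_horner1 -/(h _ _) -/e scaleNr addrC; apply: b'0.
  by move=> _; rewrite dvdp1 -['X - 1]expr1 sizeXB1.
have [eb' b'e] := fe b' Nb'; have [ee _] := fe e Ne.
have actE (x : form_lie f) : exists p beta gamma,
    [/\ vsval x u = h p u + beta *: b', vsval x b' = gamma *: e, p.[1] = 0 &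
        beta * f b' b' + gamma * f u e = 0].
  have [p [beta xu]] := gen' (vsval x u); have [p' [delta xb]] := gen' (vsval x b').
  have xe : vsval x e = p.[1] *: e.
    rewrite /e form_lie_horner xu linearD linearZ /= -/(h _ b') hb'.
    rewrite -/(h _ (h _ _)) /h -end_hornerM mulrC end_hornerM -/(h _ u) -/e -/(h p e) he.
    by rewrite !hornerE subrr expr0n /= scale0r scaler0 addr0.
  have p1 : p.[1] = 0.
    have := form_lie_skew x u e; rewrite xu xe linearDl linearZl_LR linearZr_LR /=.
    rewrite end_horner_perp // b'e mulr0 addr0 => /eqP;
      rewrite -addr_eq0 -mulr2n -mulr_natl.
    by rewrite !mulf_eq0 (negPf two_neq0) (negPf hue) orbF => /eqP.
  have [gamma hp'] : exists gamma, h p' u = gamma *: e.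
    have : N (vsval x b') = 0 by rewrite -form_lie_asym -linearB /= Nb' linear0.
    rewrite xb -end_hornerXB1 linearD linearZ /= (end_hornerXB1 _ b') Nb' scaler0 addr0.
    rewrite /h -end_hornerM => /ann; rewrite exprS dvdp_mul2l; last first.
      by rewrite -size_poly_eq0 -['X - 1]expr1 sizeXB1.
    by case/dvdpP => r ->; exists r.[1]; rewrite end_hornerM -/(h _ u) -/e -/(h r e) he.
  have d0 : delta = 0.
    have fl : f (gamma *: e + delta *: b') b' = delta * f b' b'.
      by rewrite linearDl !linearZl_LR /= eb' mulr0 add0r.
    have fr : f b' (gamma *: e + delta *: b') = delta * f b' b'.
      by rewrite linearDr !linearZr_LR /= b'e mulr0 add0r.
    have := form_lie_skew x b' b'; rewrite xb hp' fl fr => /eqP.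
    rewrite -addr_eq0 -mulr2n -mulr_natl !mulf_eq0 (negPf two_neq0) (negPf bb') orbF.
    by move/eqP.
  exists p, beta, gamma; split=> //; first by rewrite xb hp' d0 scale0r addr0.
  have := form_lie_skew x u b'; rewrite xu xb hp' d0 scale0r addr0 linearDl.
  rewrite linearZl_LR linearZr_LR /= end_horner_perp // ub' mulr0 add0r.
  by move=> ->; rewrite addNr.
apply: form_lie_abelian => x y v.
have [p [beta [gamma [xu xb p1 xbg]]]] := actE x.
have [q [beta' [gamma' [yu yb q1 ybg]]]] := actE y.
have act_e (x' : form_lie f) p' beta'' : vsval x' u = h p' u + beta'' *: b' ->
    p'.[1] = 0 -> vsval x' e = 0.
  move=> x'u p'1; rewrite /e form_lie_horner x'u linearD linearZ /= -/(h _ b') hb'.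
  rewrite -/(h _ (h _ _)) /h -end_hornerM mulrC end_hornerM -/(h _ u) -/e -/(h p' e) he.
  by rewrite p'1 !hornerE subrr expr0n /= !scale0r scaler0 addr0.
have xe := act_e x p beta xu p1; have ye := act_e y q beta' yu q1.
have cross : beta' * gamma = beta * gamma'.
  apply: (mulIf hue); apply: (mulIf bb'); apply/eqP; rewrite -subr_eq0; apply/eqP.
  have -> : beta' * gamma * f u e * f b' b' - beta * gamma' * f u e * f b' b' =
    beta' * f b' b' * (beta * f b' b' + gamma * f u e) -
    beta * f b' b' * (beta' * f b' b' + gamma' * f u e) by ring.
  by rewrite xbg ybg !mulr0 subrr.
have act_lin (x' : form_lie f) p' v' k' :
    vsval x' (h p' v' + k' *: b') = h p' (vsval x' v') + k' *: vsval x' b'.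
  by rewrite linearD linearZ /= form_lie_horner.
have comm_u : vsval x (vsval y u) = vsval y (vsval x u).
  have hlin p' v1 k' : h p' (v1 + k' *: b') = h p' v1 + k' *: h p' b'.
    by rewrite /h linearD linearZ.
  rewrite yu xu !act_lin xu yu xb yb !hlin !hb' p1 q1.
  rewrite !scale0r !scaler0 !addr0 !scalerA cross.
  by congr (_ + _); rewrite /h -!end_hornerM mulrC.
have comm_b : vsval x (vsval y b') = vsval y (vsval x b').
  by rewrite yb xb !linearZ /= xe ye !scaler0.
have [r [delta ->]] := gen' v.
have act_b2 (x' y' : form_lie f) : vsval x' (vsval y' (h r u + delta *: b')) =
    h r (vsval x' (vsval y' u)) + delta *: vsval x' (vsval y' b').
  by rewrite act_lin linearD linearZ /= form_lie_horner.
by rewrite !act_b2 comm_u comm_b.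
Qed.

(** [z = (sigma - 1) a] where [a], the inverse of [1 + sigma], is invertible. *)
Lemma cayley_pow a : (forall v, end_horner sigma a (v + sigma v) = v) ->
  forall j v, end_horner sigma (('X - 1) ^+ j) v = 0 <-> iter j (cayley a) v = 0.
Proof.
move=> a_inv j v; have powE : iter j (cayley a) v =
    end_horner sigma (a ^+ j) (end_horner sigma (('X - 1) ^+ j) v).
  by rewrite -end_horner_expn -end_hornerM exprMn mulrC.
have inv j' w : end_horner sigma (('X + 1) ^+ j') (end_horner sigma (a ^+ j') w) = w.
  rewrite -end_hornerM -exprMn mulrC; elim: j' => [|j' IHj];
    first by rewrite expr0 end_horner1.
  rewrite exprSr end_hornerM end_hornerM end_hornerD.
  by rewrite end_hornerX end_horner1 [sigma w + w]addrC a_inv IHj.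
rewrite powE; split=> [->|pow0]; first by rewrite linear0.
by rewrite -[LHS](inv j) pow0 linear0.
Qed.

Lemma cyclic_span_horner a n u w : w \in cyclic_span (cayley a) n u ->
  exists p, w = end_horner sigma p u.
Proof.
rewrite /cyclic_span -[mkseq _ _]/(val [tuple of mkseq (fun i => iter i (cayley a) u)
  n.+1]).
move/coord_span=> ->; set c := coord _;
  exists (\sum_(i < n.+1) c i w *: (('X - 1) * a) ^+ i).
have sumE (I : Type) (r : seq I) (P : pred I) (G : I -> {poly F}) :
    end_horner sigma (\sum_(i <- r | P i) G i) u =
      \sum_(i <- r | P i) end_horner sigma (G i) u.
  exact: (big_morph (fun p => end_horner sigma p u) (fun p q => end_hornerD sigma p q u)
    (end_horner0 sigma u)).
rewrite sumE; apply: eq_bigr => i _; rewrite end_hornerZ end_horner_expn.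
by rewrite /= nth_mkseq.
Qed.

(** The Cayley-Hamilton theorem, carried to [V] along a coordinate map [r]. *)
Lemma end_horner_row n (A : 'M[F]_n) (r : V -> 'rV[F]_n) v : (0 < n)%N ->
    linear r -> (forall w, r (sigma w) = r w *m A) ->
  r (end_horner sigma (char_poly A) v) = 0.
Proof.
case: n A r => // n A r _ r_lin rA.
have r0 : r 0 = 0 by have := r_lin (-1) 0 0; rewrite scaler0 addr0 scaleN1r addNr.
have rE p : r (end_horner sigma p v) = r v *m horner_mx A p.
  elim/poly_ind: p => [|p c IHp]; first by rewrite end_horner0 r0 !linear0.
  rewrite end_hornerD end_hornerMX end_hornerC addrC r_lin rA IHp.
  rewrite rmorphD rmorphM /= horner_mx_X horner_mx_C mulmxDr mulmxA mul_mx_scalar.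
  exact: addrC.
by rewrite rE Cayley_Hamilton mulmx0.
Qed.

Lemma end_char_poly_annul v : (0 < \dim {:V})%N ->
  end_horner sigma (end_char_poly sigma) v = 0.
Proof.
move=> dimV; set e := vbasis {:V}; have e_basis : basis_of {:V} e by apply: vbasisP.
apply/eqP; rewrite -(passmx.rVof_eq0 e_basis); apply/eqP.
apply: (end_horner_row (A := passmx.mxof e e sigma) (r := passmx.rVof e)) => // [|w].
  by move=> k u w; apply/rowP => i; rewrite !mxE linearP.
by rewrite /= (passmx.rVof_app _ e_basis).
Qed.

(** [('X - 1) ^+ n.+1] generates the annihilator of [sigma], hence divides the
characteristic polynomial; the bound on the dimension makes them equal. *)
Lemma cyclic_intro n u : (0 < \dim {:V} <= n.+1)%N ->
    end_horner sigma (('X - 1) ^+ n.+1) u = 0 ->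
    end_horner sigma (('X - 1) ^+ n) u != 0 ->
    (forall v, exists p, v = end_horner sigma p u) ->
  end_cyclic sigma.
Proof.
case/andP=> dimV dim_le u_nil u_top gen; split; first exact: char_poly_monic.
have annul q : end_horner sigma q = 0 <-> ('X - 1) ^+ n.+1 %| q.
  split=> [q0|dvd_q].
    by apply/(end_horner_XB1_eq0 _ u_nil u_top); rewrite q0 zero_lfunE.
  apply/lfunP => v; rewrite zero_lfunE; have [p ->] := gen v.
  rewrite -end_hornerM mulrC end_hornerM; have := dvd_q.
  by move/(end_horner_XB1_eq0 _ u_nil u_top) ->; rewrite linear0.
have dvd_char : ('X - 1) ^+ n.+1 %| end_char_poly sigma.
  apply/(end_horner_XB1_eq0 _ u_nil u_top); exact: end_char_poly_annul.
have charE : end_char_poly sigma = ('X - 1) ^+ n.+1.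
  apply/eqP; rewrite eq_sym -eqp_monic ?char_poly_monic //; last first.
    by rewrite -polyC1 monic_exp // monicXsubC.
  rewrite -dvdp_size_eqp // sizeXB1 size_char_poly eqn_leq !ltnS dim_le andbT.
  have := dvdp_leq _ dvd_char; rewrite sizeXB1 size_char_poly ltnS; apply.
  by rewrite monic_neq0 // char_poly_monic.
by move=> q; rewrite charE.
Qed.


(** ** Forms with two blocks of size 2 *)

(** Both blocks have size 2, so [z ^ 2 = 0] and any vector outside [ker z] gives
an adapted pair; the pair spans [V] with its image under [z] because [V] has
dimension at most 4. *)
Lemma two_blocks_isom u b :
    (forall v, exists p q, v = end_horner sigma p u + end_horner sigma q b) ->
    (forall p q, end_horner sigma p u + end_horner sigma q b = 0 <->
       ('X - 1) ^+ 2 %| p /\ ('X - 1) ^+ 2 %| q) ->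
  lie_isom (form_lie f) (lie_gl 2 F).
Proof.
move=> gen rel; have [al a_inv] := one_plus_sigma_inv.
set z := cayley al.
have nilu : end_horner sigma (('X - 1) ^+ 2) u = 0.
  have := iffRL (rel (('X - 1) ^+ 2) 0) (conj (dvdpp _) (dvdp0 _)).
  by rewrite end_horner0 addr0.
have nilb : end_horner sigma (('X - 1) ^+ 2) b = 0.
  have := iffRL (rel 0 (('X - 1) ^+ 2)) (conj (dvdp0 _) (dvdpp _)).
  by rewrite end_horner0 add0r.
have zz0 v : z (z v) = 0.
  apply/(cayley_pow a_inv 2); have [p [q ->]] := gen v.
  have hC p' w : end_horner sigma (('X - 1) ^+ 2) (end_horner sigma p' w) =
      end_horner sigma p' (end_horner sigma (('X - 1) ^+ 2) w).
    by rewrite -!end_hornerM mulrC.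
  by rewrite linearD /= !hC nilu nilb !linear0 addr0.
have zu : z u != 0.
  apply/eqP => zu0; have [] := iffLR (rel ('X - 1) 0).
    by rewrite end_horner0 addr0; apply/(cayley_pow a_inv 1 u).
  by move/dvdp_leq; rewrite -['X
    - 1]expr1 -exprM !sizeXB1 -size_poly_eq0 sizeXB1 => /(_ isT).
have g_nondeg := symform_nondeg a_inv; have z_skew := cayley_skew a_inv.
have g_sym := symform_sym.
have [v0] := form_witness g_nondeg zu; rewrite g_sym => zuv0.
have [a [c ac]] := adapted_exists two_neq0 g_sym z_skew zz0 zuv0.
have E := adapted_pairing two_neq0 g_sym z_skew ac.
have iso := square0_isotropic z_skew zz0.
pose X := [tuple a; c; z a; z c].
have dimV : (\dim {:V} <= 4)%N.
  pose Y := [:: u; sigma u; b; sigma b].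
  have Y_mem w p : w \in Y -> sigma w \in Y -> end_horner sigma (('X - 1) ^+ 2) w = 0 ->
      end_horner sigma p w \in <<Y>>%VS.
    move=> wY swY w_nil; rewrite (divp_eq p (('X - 1) ^+ 2)) end_hornerD end_hornerM.
    have lt_size : (size (p %% ('X - 1) ^+ 2)%R <= 2)%N.
      by rewrite -ltnS -(sizeXB1 F 2) ltn_modp -size_poly_eq0 sizeXB1.
    rewrite w_nil linear0 add0r (end_hornerE _ _ lt_size) !big_ord_recl big_ord0 addr0.
    by rewrite memvD ?memvZ ?memv_span.
  rewrite -(size_tuple [tuple u; sigma u; b; sigma b]); apply: leq_trans (dim_span _).
  apply: dimvS; apply/subvP => v _; have [p [q ->]] := gen v.
  by rewrite memvD ?Y_mem // !inE eqxx ?orbT.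
have X_full : <<X>>%VS = fullv.
  have free_X : free X.
    apply/freeP => l; rewrite !big_ord_recl big_ord0 addr0 /= => l0.
    set l0' := l _ in l0; set l1 := l _ in l0; set l2 := l _ in l0; set l3 := l _ in l0.
    have pair w : l0' * g a w + (l1 * g c w + (l2 * g (z a) w + l3 * g (z c) w)) = 0.
      have := congr1 (fun v => g v w) l0.
      by rewrite linear0l !linearDl !linearZl_LR /=.
    move: (pair (z c)) (pair (z a)) (pair c) (pair a).
    rewrite !E !iso !(mulr0, mulr1, mulrN, addr0, add0r) => l00 /eqP + /eqP.
    rewrite !oppr_eq0 => /eqP l10 /eqP l20 l30.
    case=> [[|[|[|[|//]]]] lt_i]; [rewrite -l00|rewrite -l10|rewrite -l20|rewrite -l30];
      by congr l; apply: val_inj.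
  apply/eqP; rewrite eqEdim subvf; move: free_X; rewrite /free size_tuple => /eqP->.
  exact: dimV.
have span_ac v : v = adapted_proj g z a c v.
  have [va vc vza vzc] := adapted_projP two_neq0 g_sym z_skew zz0 ac v.
  apply/eqP; rewrite -subr_eq0; apply/eqP/g_nondeg => w.
  have /coord_span -> : w \in <<X>>%VS by rewrite X_full memvf.
  rewrite !big_ord_recl big_ord0 addr0 !linearDr !linearZr_LR /=.
  by rewrite va vc vza vzc !mulr0 !addr0.
pose ent := gl_entry g z a c.
pose phif (x : form_lie f) : lie_gl 2 F := \matrix_(i, j) ent i j (vsval x).
have phi_lin : linear phif.
  by move=> l x y; apply/matrixP => i j; rewrite !mxE -gl_entry_linear linearP.
pose phi : {linear form_lie f -> lie_gl 2 F} :=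
  HB.pack phif (GRing.isLinear.Build F (form_lie f) (lie_gl 2 F) _ phif phi_lin).
have cent (x : form_lie f) : skew_cent g z (vsval x).
  by apply/(form_skew_centP a_inv)/subvsP.
exists phi; split.
  have surj (M : lie_gl 2 F) : exists x : form_lie f, phi x == M.
    have [x /(form_skew_centP a_inv) xL xM] :=
      gl_entry_surj two_neq0 g_sym z_skew zz0 ac M.
    exists (vsproj (form_skew f) x); apply/eqP/matrixP => i j.
    by rewrite mxE vsprojK // /ent xM.
  have inj : injective phi.
    move=> x y xy; apply/eqP; rewrite -subr_eq0; apply/eqP.
    suff xy0 : vsval (x - y) = 0 by apply: val_inj; rewrite [LHS]xy0 [RHS]linear0.
    apply: (gl_entry_inj two_neq0 g_sym z_skew span_ac) => [|i j]; first exact: cent.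
    have /matrixP/(_ i j) : phi (x - y) = 0 by rewrite linearB xy subrr.
    by rewrite !mxE.
  exists (fun M => xchoose (surj M)) => [x|M]; last exact/eqP/(xchooseP (surj M)).
  by apply: inj; apply/eqP/(xchooseP (surj (phi x))).
move=> x y; apply/matrixP => i j; rewrite [lie_br x y]/(form_lie_br x y).
rewrite [LHS]mxE form_lie_brE /ent (gl_entry_comm two_neq0 g_sym z_skew zz0 ac span_ac)
  //.
rewrite [lie_br _ _]/(lie_gl_br _ _) /lie_gl_br [RHS]mxE [X in _ = _ + X]mxE 2!mxE.
by congr (_ - _); apply: eq_bigr => k' _; rewrite !mxE.
Qed.

(** ** The blocks of the asymmetry of a form with reductive Lie algebra *)

(** The generators found for [z] are also generators for [sigma]: [z] is a
polynomial in [sigma], and the two have the same exact orders on vectors. *)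
Lemma reductive_blocks : (0 < \dim {:V})%N -> lie_reductive (form_lie f) ->
  end_cyclic sigma
  \/ sigma = \1%VF
  \/ end_elementary_divisors sigma [:: ('X - 1) ^+ 2; ('X - 1) ^+ 2]
  \/ exists2 m : nat, (1 <= m)%N &
       end_elementary_divisors sigma [:: ('X - 1) ^+ (2 * m + 1); 'X - 1].
Proof.
move=> dimV redL; have [al a_inv] := one_plus_sigma_inv; set z := cayley al.
have cayley_sigma := cayleyE a_inv; have pow := cayley_pow a_inv.
have g_nondeg := symform_nondeg a_inv; have z_skew := cayley_skew a_inv.
have g_sym := symform_sym; have nil_central := reductive_nil_central a_inv redL.
have [z0|z_neq0] := eqVneq z 0.
  right; left; apply/lfunP => v; rewrite id_lfunE; apply/eqP.
  by rewrite -subr_eq0 -cayley_sigma -/z z0 zero_lfunE.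
have [] := nil_central_classification two_neq0 g_sym g_nondeg z_skew (cayley_nil al)
  z_neq0 nil_central.
  case=> n [u [n_gt0 n_even z_nil u_top [span_u|[b [zb bb bu span_ub]]]]].
    left; apply: (cyclic_intro (n := n) (u := u)).
    - rewrite dimV /= -[n.+1](size_mkseq (fun i => iter i z u)).
      by apply: leq_trans (dim_span _); apply/dimvS/subvP => v _; apply: span_u.
    - by apply/pow.
    - by apply: contraNneq u_top => /pow ->.
    by move=> v; apply: cyclic_span_horner (span_u v).
  right; right; right; exists n./2.
    by rewrite -double_gt0; have := odd_double_half n; rewrite (negPf n_even) add0n => ->.
  have -> : (2 * n./2 + 1 = n.+1)%N.
    by rewrite mul2n addn1 -[in RHS](odd_double_half n) (negPf n_even).
  rewrite -[X in [:: _; X]]expr1.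
  have Nb : N b = 0 by rewrite -end_hornerXB1; apply/(pow 1).
  have u_nil : end_horner sigma (('X - 1) ^+ n.+1) u = 0 by apply/pow.
  have u_top' : end_horner sigma (('X - 1) ^+ n) u != 0.
    by apply: contraNneq u_top => /pow ->.
  have gb w : g w b = 2%:R * f w b.
    have sb : sigma b = b by apply/eqP; rewrite -subr_eq0 Nb.
    by rewrite /= /symform (f_asym w b) sb; ring.
  have b_mul q : end_horner sigma q b = 0 -> 'X - 1 %| q.
    rewrite end_horner_fixed // => /eqP; rewrite scaler_eq0 => /orP[|/eqP b0].
      by rewrite -[q.[1] == 0]/(root q 1) -dvdp_XsubCl polyC1.
    by rewrite b0 linear0l eqxx in bb.
  apply: (elementary_divisors2I (u := u) (b := b)) => // [v|p q].
    have [k span_k] := span_ub v; have [p vp] := cyclic_span_horner span_k.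
    exists p, k%:P; rewrite end_hornerC -vp subrK //.
  rewrite expr1; split=> [pq0|[/(end_horner_XB1_eq0 _ u_nil u_top') -> /dvdpP[r ->]]].
    have q1 : end_horner sigma q b = 0.
      have := congr1 (fun w => g w b) pq0; rewrite linear0l linearDl /=.
      rewrite (end_horner_fixed q Nb) linearZl_LR /= gb end_horner_perp //.
      have := bu 0%N; rewrite /= g_sym gb => /eqP.
      rewrite mulf_eq0 (negPf two_neq0) => /eqP ->; rewrite !mulr0 add0r => /eqP.
      by rewrite mulf_eq0 (negPf bb) orbF => /eqP ->; rewrite scale0r.
    split; last exact: b_mul.
    apply/(end_horner_XB1_eq0 _ u_nil u_top').
    by rewrite q1 addr0 in pq0.
  by rewrite add0r end_hornerM end_hornerXB1 Nb linear0.
case=> zz0 [a [c [ac span_ac]]].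
have E := adapted_pairing two_neq0 g_sym z_skew ac.
have NN v : end_horner sigma (('X - 1) ^+ 2) v = 0.
  by apply/(pow 2%N); apply: zz0.
have Nv v : N v = 2%:R *: z v.
  have zN : z (N v) = 0.
    rewrite -end_hornerXB1 /z /cayley -end_hornerM mulrAC -expr2 mulrC end_hornerM.
    by rewrite NN linear0.
  rewrite -cayley_sigma -/z -[sigma v](subrK v) addrC -addrA linearD /= zN add0r.
  by rewrite linearD /= scaler_nat.
have eval0 k l : k *: z a + l *: z c = 0 -> k = 0 /\ l = 0.
  move=> kl0; split.
    have := congr1 (fun v => g v c) kl0.
    rewrite linear0l linearDl !linearZl_LR /= !E mulr0 addr0 mulrN1 => /eqP.
    by rewrite oppr_eq0 => /eqP.
  have := congr1 (fun v => g v a) kl0.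
  by rewrite linear0l linearDl !linearZl_LR /= !E mulr0 add0r mulr1.
have root1 p q : end_horner sigma p (N a) + end_horner sigma q (N c) = 0 ->
    'X - 1 %| p /\ 'X - 1 %| q.
  have NNv v : N (N v) = 0 by rewrite -!end_hornerXB1 -end_hornerM -expr2.
  rewrite !end_horner_fixed // !Nv !scalerA => /eval0[/eqP + /eqP].
  rewrite !mulf_eq0 (negPf two_neq0) !orbF => p1 q1.
  by rewrite -polyC1 !dvdp_XsubCl; split.
right; right; left; apply: (elementary_divisors2I (u := a) (b := c)) => // [v|p q].
  exists ((g v (z c))%:P - (g v c) *: (('X - 1) * al)),
    ((g v a) *: (('X - 1) * al) - (g v (z a))%:P).
  rewrite !end_hornerB !end_hornerC !end_hornerZ {1}[v]span_ac /adapted_proj.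
  by rewrite -!addrA; congr (_ + _); rewrite [LHS]addrC -addrA.
split=> [pq0|[/dvdpP[r ->] /dvdpP[s ->]]]; last first.
  by rewrite (end_hornerM _ r) (end_hornerM _ s) !NN !linear0 addr0.
have [/dvdpP[p1 Dp] /dvdpP[q1 Dq]] : 'X - 1 %| p /\ 'X - 1 %| q.
  have swap r v : end_horner sigma ('X - 1) (end_horner sigma r v) =
      end_horner sigma r (N v).
    by rewrite -end_hornerXB1 -!end_hornerM mulrC.
  apply: root1; have := congr1 (end_horner sigma ('X - 1)) pq0.
  by rewrite linear0 linearD /= !swap.
move: pq0; rewrite Dp Dq !end_hornerM !end_hornerXB1 => /root1[dp1 dq1].
by split; rewrite expr2 dvdp_mul2r // -size_poly_eq0 -polyC1 size_XsubC.
Qed.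
End FormPair.

(** * Symmetric forms *)

Section Symmetric.
Variables (F : fieldType) (V : vectType F).
Hypothesis two_neq0 : 2%:R != 0 :> F.
Variable f : {bilinear V -> V -> F | *%R & *%R}.
Hypothesis f_sym : form_symmetric f.
Hypothesis f_nondeg : form_nondegenerate f.
Local Notation n := (\dim {:V}).

(** Project a vector outside the span of the first [m] onto their orthogonal
complement; there it pairs nontrivially with some other vector, and [polarize]
makes it anisotropic. *)
Lemma orthogonal_seq m : (m <= n)%N -> exists e : nat -> V,
  (forall i, (i < m)%N -> f (e i) (e i) != 0) /\
  (forall i j, (i < m)%N -> (j < m)%N -> i != j -> f (e i) (e j) = 0).
Proof.
elim: m => [|m IHm] lt_mn; first by exists (fun _ => 0).
have [e [e_neq0 e_orth]] := IHm (ltnW lt_mn); pose U := <<mkseq e m>>%VS.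
have /subvPn[v _ vU] : ~~ (fullv <= U)%VS.
  apply: contraL lt_mn => /dimvS le_nU; rewrite -leqNgt (leq_trans le_nU) //.
  by rewrite (leq_trans (dim_span _)) // size_mkseq.
pose r w := w - \sum_(i < m) (f w (e i) / f (e i) (e i)) *: e i.
have r_orth w i : (i < m)%N -> f (r w) (e i) = 0.
  move=> lt_im; rewrite /r linearBl linear_sumlz (bigD1 (Ordinal lt_im)) //=.
  rewrite linearZl_LR /= divfK ?e_neq0 // big1 ?addr0 ?subrr // => j ji.
  by rewrite linearZl_LR /= (e_orth _ _ (ltn_ord j) lt_im ji) mulr0.
have rv_neq0 : r v != 0.
  apply: contraNneq vU => /eqP; rewrite subr_eq0 => /eqP->.
  apply: memv_suml => i _; apply/memvZ/memv_span/mapP; exists (nat_of_ord i) => //.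
  by rewrite mem_iota add0n ltn_ord.
have [w rvw] := form_witness f_nondeg.1 rv_neq0.
have rvrw : f (r v) (r w) != 0.
  rewrite {2}/r linearBr linear_sumr big1 ?subr0 // => i _.
  by rewrite linearZr_LR /= r_orth ?mulr0 ?ltn_ord.
have fD u1 u2 u3 : f (u1 + u2) u3 = f u1 u3 + f u2 u3 by apply: linearDl.
have [i [j /=]] := polarize two_neq0 fD f_sym rvrw; set t := _ + _ => tt.
have t_orth k : (k < m)%N -> f t (e k) = 0.
  by move=> lt_km; rewrite linearDl !linearMnl !r_orth ?mul0rn ?addr0.
exists (fun k => if k == m then t else e k); split=> [k|k l].
  by rewrite ltnS leq_eqVlt; case: eqP => //= _; apply: e_neq0.
have lt_m k' : (k' < m.+1)%N -> k' != m -> (k' < m)%N.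
  by rewrite ltnS ltn_neqAle => -> ->.
move=> lt_k lt_l; have [km|km] := eqVneq k m; have [lm|lm] := eqVneq l m => kl.
- by rewrite km lm eqxx in kl.
- by rewrite t_orth ?lt_m.
- by rewrite f_sym t_orth ?lt_m.
by rewrite e_orth ?lt_m.
Qed.

Lemma orthogonal_basis : exists e : n.-tuple V,
  [/\ basis_of {:V} e, forall i : 'I_n, f e`_i e`_i != 0 &
      forall i j : 'I_n, i != j -> f e`_i e`_j = 0].
Proof.
have [e [e_neq0 e_orth]] := orthogonal_seq (leqnn n).
pose X := [tuple e i | i < n].
have XE (i : 'I_n) : X`_i = e i by rewrite (nth_mktuple _ _ i).
exists X; split=> [|i|i j ij]; rewrite ?XE ?e_neq0 ?e_orth //.
rewrite basisEfree subvf size_tuple leqnn !andbT; apply/freeP => c c0 i.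
have := congr1 (f^~ (e i)) c0; rewrite linear_sumlz linear0l (bigD1 i) //=.
rewrite big1 => [|j ji]; last by rewrite XE linearZl_LR /= e_orth ?mulr0.
by rewrite XE addr0 linearZl_LR => /eqP;
  rewrite mulf_eq0 (negPf (e_neq0 i _)) // orbF => /eqP.
Qed.

Section SymmetricRep.
Variable e : n.-tuple V.
Hypothesis e_basis : basis_of {:V} e.
Hypothesis e_neq0 : forall i : 'I_n, f e`_i e`_i != 0.
Hypothesis e_orth : forall i j : 'I_n, i != j -> f e`_i e`_j = 0.

Definition sym_rep (x : form_lie f) : 'M[F]_n :=
  \matrix_(i, j) (f (vsval x e`_j) e`_i / f e`_i e`_i).

Fact sym_rep_linear : linear sym_rep.
Proof.
move=> k x y; apply/matrixP => i j; rewrite !mxE linearP /= add_lfunE scale_lfunE.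
by rewrite linearPl mulrDl mulrA.
Qed.
HB.instance Definition _ :=
  GRing.isLinear.Build F (form_lie f) 'M[F]_n _ sym_rep sym_rep_linear.

Lemma orth_expand v : v = \sum_(i < n) (f v e`_i / f e`_i e`_i) *: e`_i.
Proof.
rewrite {1}(coord_basis e_basis (memvf v)); apply: eq_bigr => i _; congr (_ *: _).
rewrite {2}(coord_basis e_basis (memvf v)) linear_sumlz (bigD1 i) //=.
rewrite big1 => [|j ji]; last by rewrite linearZl_LR /= e_orth ?mulr0.
by rewrite addr0 linearZl_LR /= mulfK.
Qed.

Lemma sym_rep_br x y :
  sym_rep (lie_br x y) = sym_rep x *m sym_rep y - sym_rep y *m sym_rep x.
Proof.
have mulE (x' y' : form_lie f) i j : (sym_rep x' *m sym_rep y') i j =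
    f (vsval x' (vsval y' e`_j)) e`_i / f e`_i e`_i.
  rewrite mxE [vsval y' _ in RHS]orth_expand linear_sum linear_sumlz mulr_suml.
  apply: eq_bigr => k _; rewrite !mxE linearZ linearZl_LR /= mulrC; ring.
apply/matrixP => i j; rewrite mxE lie_br_val linearBl mulrBl -!mulE.
by rewrite !mxE.
Qed.

Lemma sym_rep_inj x : sym_rep x = 0 -> x = 0.
Proof.
move=> x0; suff x0' : vsval x = 0 by apply: val_inj; rewrite [LHS]x0' [RHS]linear0.
have xe (j : 'I_n) : vsval x e`_j = 0.
  rewrite [LHS]orth_expand big1 // => i _.
  by have /matrixP/(_ i j) := x0; rewrite !mxE => ->; rewrite scale0r.
apply/lfunP => v; rewrite zero_lfunE (orth_expand v) linear_sum big1 // => i _.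
by rewrite linearZ /= xe scaler0.
Qed.

Let d (i : 'I_n) := f e`_i e`_i.

Lemma sym_rep_skew x i j : d i * sym_rep x i j = - (d j * sym_rep x j i).
Proof.
rewrite !mxE /d ![_ * (_ / _)]mulrC !divfK //.
by rewrite form_lie_skew f_sym.
Qed.

Lemma sym_rep_surj i j : exists x, sym_rep x = skew_unit d i j.
Proof.
pose k := (d i * d j)^-1; pose r := k *: wedge f e`_i e`_j.
have rE v : r v = k *: (f e`_j v *: e`_i - f e`_i v *: e`_j).
  by rewrite scale_lfunE wedgeE.
have rL : r \in form_skew f.
  apply/form_skewP => v w; rewrite !rE linearZl_LR linearZr_LR linearBl linearBr /=.
  rewrite !linearZl_LR !linearZr_LR /= (f_sym v e`_i) (f_sym v e`_j); ring.
have fE (p q : 'I_n) : f e`_p e`_q = (p == q)%:R * d p.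
  by have [->|pq] := eqVneq p q; rewrite ?mul1r // e_orth // mul0r.
exists (vsproj (form_skew f) r); apply/matrixP => p q; rewrite !mxE vsprojK // rE.
rewrite linearZl_LR linearBl !linearZl_LR /= !fE -!mulnb !natrM.
rewrite (eq_sym p i) (eq_sym p j) (eq_sym q i) (eq_sym q j) eqxx mul1r /k /d.
by field; rewrite !e_neq0.
Qed.

End SymmetricRep.

(** In an orthogonal basis over [F], the matrices of [L(f)] are skew for a
diagonal form and include all the skew matrix units; both properties pass to
[K]. *)
Lemma symmetric_reductive (K : fieldType) (iota : {rmorphism F -> K}) :
  lie_absolutely_reductive iota (form_lie f).
Proof.
have [e [e_basis e_neq0 e_orth]] := orthogonal_basis.
have rep_br := sym_rep_br e_basis e_neq0 e_orth.
have rep_inj := sym_rep_inj e_basis e_neq0 e_orth.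
have rep_skew := sym_rep_skew e_neq0.
have rep_surj := sym_rep_surj e_neq0 e_orth.
split; first exact: (orthogonal_reductive two_neq0 rep_br rep_inj e_neq0 rep_skew).
have two_neq0' : 2%:R != 0 :> K by rewrite -(rmorph_nat iota) fmorph_eq0.
pose d (i : 'I_n) := iota (f e`_i e`_i).
have d_neq0 i : d i != 0 by rewrite fmorph_eq0.
apply: (orthogonal_reductive two_neq0' (ext_rep_br (iota := iota) rep_br)
  (ext_rep_inj rep_inj) d_neq0) => [x i j|i j].
  rewrite /ext_rep !summxE !mulr_sumr -sumrN; apply: eq_bigr => k _.
  rewrite !mxE [LHS]mulrCA [in RHS]mulrCA -mulrN; congr (_ * _).
  by rewrite -!rmorphM -rmorphN; congr (iota _); have :=
    rep_skew (vbasis {:form_lie f})`_k i j;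
    rewrite !mxE.
have [x x_ij] := rep_surj i j; exists (lie_ext_in iota x).
rewrite [LHS]ext_rep_in /= x_ij; apply/matrixP => p q; rewrite !mxE.
by rewrite rmorphM fmorphV rmorphB !rmorph_nat.
Qed.

End Symmetric.

(** * Lie algebras of known type *)

Lemma abelian_absolutely_reductive (F K : fieldType) (iota : {rmorphism F -> K})
  (L : lieAlgType F) : lie_abelian L -> lie_absolutely_reductive iota L.
Proof.
move=> abL; split; apply: lie_abelian_reductive => // x y.
rewrite [lie_br x y]/(lie_ext_br x y) /lie_ext_br big1 // => i _; rewrite big1 // => j _.
by rewrite abL lie_ext_in0 scaler0.
Qed.

Lemma gl2_absolutely_reductive (F K : fieldType) (iota : {rmorphism F -> K})
    (L : lieAlgType F) : 2%:R != 0 :> F ->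
  lie_isom L (lie_gl 2 F) -> lie_absolutely_reductive iota L.
Proof.
move=> two_neq0 [phi0 [bij_phi phi0_br]].
have phi_lin : linear (phi0 : L -> 'M[F]_2) by move=> k x y; apply: linearP.
pose phi : {linear L -> 'M[F]_2} :=
  HB.pack (phi0 : L -> 'M[F]_2) (GRing.isLinear.Build F L 'M[F]_2 _ phi0 phi_lin).
have phi_br x y : phi (lie_br x y) = phi x *m phi y - phi y *m phi x by apply: phi0_br.
have phi_inj x : phi x = 0 -> x = 0.
  by move=> x0; apply: (bij_inj bij_phi); rewrite linear0; apply: x0.
have phi_surj M : exists x, phi x = M.
  by have [psi _ psiK] := bij_phi; exists (psi M); apply: psiK.
split; first by apply: (gl2_reductive two_neq0 phi_br phi_inj) => i j; apply: phi_surj.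
have two_neq0' : 2%:R != 0 :> K by rewrite -(rmorph_nat iota) fmorph_eq0.
apply: (gl2_reductive two_neq0' (ext_rep_br (iota := iota) phi_br) (ext_rep_inj phi_inj)).
move=> i j; have [x x_ij] := phi_surj (delta_mx i j); exists (lie_ext_in iota x).
by rewrite [LHS]ext_rep_in x_ij map_delta_mx.
Qed.

Theorem proposition10p6
    (F : fieldType) (hF : 2%N \notin [pchar F])
    (K : closedFieldType) (iota : {rmorphism F -> K})
    (hK : forall z : K, algebraicOver iota z)
    (V : vectType F) (hV : (0 < \dim {:V})%N)
    (f : {bilinear V -> V -> F | *%R & *%R}) (hf : form_nondegenerate f)
    (sigma : 'End(V)) (hsigma : form_asymmetry f sigma)
    (hunip : end_unipotent sigma) :
  (lie_absolutely_reductive iota (form_lie f) <->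
     end_cyclic sigma
     \/ sigma = \1%VF
     \/ end_elementary_divisors sigma [:: ('X - 1) ^+ 2; ('X - 1) ^+ 2]
     \/ exists2 m : nat, (1 <= m)%N &
          end_elementary_divisors sigma [:: ('X - 1) ^+ (2 * m + 1); 'X - 1])
  /\ (end_cyclic sigma -> lie_abelian (form_lie f))
  /\ (sigma = \1%VF -> form_symmetric f)
  /\ (end_elementary_divisors sigma [:: ('X - 1) ^+ 2; ('X - 1) ^+ 2] ->
        lie_isom (form_lie f) (lie_gl 2 F))
  /\ (forall m : nat, (1 <= m)%N ->
        end_elementary_divisors sigma [:: ('X - 1) ^+ (2 * m + 1); 'X - 1] ->
        lie_abelian (form_lie f)).
Proof.
have two_neq0 : 2%:R != 0 :> F by move: hF; rewrite inE.
have cyclic_ab : end_cyclic sigma -> lie_abelian (form_lie f).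
  exact: cyclic_abelian.
have one_sym : sigma = \1%VF -> form_symmetric f.
  by move=> s1 v w; rewrite (hsigma w) s1 id_lfunE.
have two_gl : end_elementary_divisors sigma [:: ('X - 1) ^+ 2; ('X - 1) ^+ 2] ->
    lie_isom (form_lie f) (lie_gl 2 F).
  move/elementary_divisors2P => [u [b [gen rel]]].
  exact: (two_blocks_isom two_neq0 hf hsigma hunip gen rel).
have hook_ab m : (1 <= m)%N ->
    end_elementary_divisors sigma [:: ('X - 1) ^+ (2 * m + 1); 'X - 1] ->
    lie_abelian (form_lie f).
  move=> m_gt0 /elementary_divisors2P[u [b [gen rel]]].
  apply: (hook_abelian two_neq0 hf hsigma _ gen rel).
  by rewrite addn1 ltnS muln_gt0.
split; last by [].
split=> [[redL _]|]; first exact: (reductive_blocks two_neq0 hf hsigma hunip hV redL).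
case=> [/cyclic_ab abL|[/one_sym f_sym|[/two_gl isoL|[m m_gt0 /(hook_ab m m_gt0) abL]]]].
- exact: abelian_absolutely_reductive.
- exact: symmetric_reductive.
- exact: gl2_absolutely_reductive.
exact: abelian_absolutely_reductive.
Qed.
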